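(* Every element $W$ of $SB_n$ can be written uniquely in left-greedy form, and uniquely in right-greedy form.
   Context: Fix $n\ge 2$. $SB_n$ is the monoid with generators $\sigma_i,\sigma_i^{-1},x_i$ ($i=1,\dots,n-1$) and relations: $\sigma_i\sigma_j=\sigma_j\sigma_i$ and $x_ix_j=x_jx_i$ if $|i-j|>1$; $x_i\sigma_j=\sigma_jx_i$ if $|i-j|\ne1$; $\sigma_i\sigma_{i+1}\sigma_i=\sigma_{i+1}\sigma_i\sigma_{i+1}$; $\sigma_i\sigma_{i+1}x_i=x_{i+1}\sigma_i\sigma_{i+1}$; $\sigma_{i+1}\sigma_ix_{i+1}=x_i\sigma_{i+1}\sigma_i$; $\sigma_i\sigma_i^{-1}=\sigma_i^{-1}\sigma_i=1$. $SB_n^+$ is the monoid with generators $\sigma_i,x_i$ and all these relations except the last; $Br_n^+\subseteq SB_n^+$ is the submonoid generated by the $\sigma_i$. $\Delta=\sigma_1\cdots\sigma_{n-1}\,\sigma_1\cdots\sigma_{n-2}\cdots\sigma_1\sigma_2\,\sigma_1$. Left-greedy form of a positive braid $P\in Br_n^+$: $P=A_1\cdots A_r$ where each $A_j\ne1$ is a left divisor of $\Delta$ in $Br_n^+$ (a positive permutation braid) and each $A_j$ is the greatest common left divisor of $\Delta$ and $A_jA_{j+1}\cdots A_r$ (successive longest possible fragments of $\Delta$). Left-greedy form for $SB_n$: write $W=\Delta^tW'$ with $t\in\mathbb Z$ maximal and $W'\in SB_n^+$ not left divisible by $\Delta$ (Garside left normal form). Let $S_1$ be the greatest left divisor of $W'$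 lying in $Br_n^+$ and $W'=S_1T$; write $S_1$ in its left-greedy form. If $T\ne1$, let $x_{i_1}$ be the left divisor of $T$ among $x_1,\dots,x_{n-1}$ with smallest index and $T=x_{i_1}T_1$; then repeat with $T_1$ in place of $W'$ (greatest $Br_n^+$-left divisor, written in left-greedy form, then smallest $x$-left divisor, etc.). Grouping consecutive letters $x_j$ with no braid part between them yields an expression $W=\Delta^tS_1X_1\cdots S_kX_k$, where each $S_i$ is a product of left-greedy fragments of a positive braid and each $X_i$ is a product of letters $x_j$; this is called the left-greedy form of $W$. The right-greedy form is defined symmetrically (with right divisors, reading from the right). *)

(* Defs.v *)
From mathcomp Require Import all_boot all_algebra.
From Stdlib Require List.
Set Implicit Arguments. Unset Strict Implicit. Unset Printing Implicit Defensive.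

(* sg i = sigma_i, sgi i = sigma_i^{-1}, xg i = x_i  (indices 1 .. n-1) *)
Inductive letter : Type := sg of nat | sgi of nat | xg of nat.

Definition lidx (l : letter) : nat := match l with sg i | sgi i | xg i => i end.
Definition idx_ok (n i : nat) : Prop := (0 < i)%N /\ (i < n)%N.

Definition valid_word (n : nat) (w : seq letter) : Prop :=
  forall l, List.In l w -> idx_ok n (lidx l).
Definition pos_word (n : nat) (w : seq letter) : Prop :=
  forall l, List.In l w -> idx_ok n (lidx l) /\ (forall i, l <> sgi i).
Definition braid_word (n : nat) (w : seq letter) : Prop :=
  forall l, List.In l w -> exists2 i, idx_ok n i & l = sg i.

Inductive sbrel (inv : bool) (n : nat) : seq letter -> seq letter -> Prop :=
| r_ss i j : idx_ok n i -> idx_ok n j -> (i.+1 < j \/ j.+1 < i)%N ->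
    sbrel inv n [:: sg i; sg j] [:: sg j; sg i]
| r_xx i j : idx_ok n i -> idx_ok n j -> (i.+1 < j \/ j.+1 < i)%N ->
    sbrel inv n [:: xg i; xg j] [:: xg j; xg i]
| r_xs i j : idx_ok n i -> idx_ok n j -> i <> j.+1 -> j <> i.+1 ->
    sbrel inv n [:: xg i; sg j] [:: sg j; xg i]
| r_braid i : idx_ok n i -> idx_ok n i.+1 ->
    sbrel inv n [:: sg i; sg i.+1; sg i] [:: sg i.+1; sg i; sg i.+1]
| r_sx1 i : idx_ok n i -> idx_ok n i.+1 ->
    sbrel inv n [:: sg i; sg i.+1; xg i] [:: xg i.+1; sg i; sg i.+1]
| r_sx2 i : idx_ok n i -> idx_ok n i.+1 ->
    sbrel inv n [:: sg i.+1; sg i; xg i.+1] [:: xg i; sg i.+1; sg i]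
| r_inv1 i : inv = true -> idx_ok n i -> sbrel inv n [:: sg i; sgi i] [::]
| r_inv2 i : inv = true -> idx_ok n i -> sbrel inv n [:: sgi i; sg i] [::].

Inductive sbeq (inv : bool) (n : nat) : seq letter -> seq letter -> Prop :=
| sbeq_step a b u v : sbrel inv n u v -> sbeq inv n (a ++ u ++ b) (a ++ v ++ b)
| sbeq_refl u : sbeq inv n u u
| sbeq_sym u v : sbeq inv n u v -> sbeq inv n v u
| sbeq_trans u v w : sbeq inv n u v -> sbeq inv n v w -> sbeq inv n u w.

Definition eqP_ (n : nat) := sbeq false n.
Definition eqG (n : nat) := sbeq true n.

Definition ldiv n (a b : seq letter) := exists2 c, pos_word n c & eqP_ n (a ++ c) b.
Definition rdiv n (a b : seq letter) := exists2 c, pos_word n c & eqP_ n (c ++ a) b.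
Definition brldiv n (a b : seq letter) := exists2 c, braid_word n c & eqP_ n (a ++ c) b.
Definition brrdiv n (a b : seq letter) := exists2 c, braid_word n c & eqP_ n (c ++ a) b.

Definition delta (n : nat) : seq letter :=
  flatten [seq [seq sg j | j <- iota 1 k] | k <- rev (iota 1 n.-1)].
Definition delta_inv (n : nat) : seq letter :=
  rev [seq match l with sg i => sgi i | sgi i => sg i | xg i => xg i end
      | l <- delta n].
Definition deltapow (n : nat) (t : int) : seq letter :=
  match t with
  | Posz k => flatten (nseq k (delta n))
  | Negz k => flatten (nseq k.+1 (delta_inv n))
  end.

(* FPerm u : a fragment of a positive braid (u a word in the sigma_i);
   FX i : a letter x_i. *)
Inductive frag : Type := FPerm of seq letter | FX of nat.
Definition frag_word (f : frag) : seq letter :=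
  match f with FPerm u => u | FX i => [:: xg i] end.
Definition fword (fs : seq frag) : seq letter := flatten (map frag_word fs).

(* two fragment lists are the same expression: same length, braid fragments
   equal in SB_n^+ (equivalently Br_n^+), x-letters with equal indices *)
Fixpoint same_frags (n : nat) (fs gs : seq frag) : Prop :=
  match fs, gs with
  | [::], [::] => True
  | FPerm u :: fs', FPerm v :: gs' => eqP_ n u v /\ same_frags n fs' gs'
  | FX i :: fs', FX j :: gs' => i = j /\ same_frags n fs' gs'
  | _, _ => False
  end.

Definition lfrag_ok n (A P : seq letter) : Prop :=
  braid_word n A /\ ~ eqP_ n A [::] /\ brldiv n A (delta n) /\ brldiv n A P /\
  (forall C, braid_word n C -> brldiv n C (delta n) -> brldiv n C P -> brldiv n C A).

Fixpoint lgreedy_braid n (As : seq (seq letter)) : Prop :=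
  match As with
  | [::] => True
  | A :: As' => lfrag_ok n A (A ++ flatten As') /\ lgreedy_braid n As'
  end.

Definition greatest_br_ldiv n (B U : seq letter) : Prop :=
  braid_word n B /\ ldiv n B U /\
  (forall C, braid_word n C -> ldiv n C U -> ldiv n C B).

Inductive lg_tail (n : nat) : seq frag -> Prop :=
| lgt_end As :
    lgreedy_braid n As ->
    greatest_br_ldiv n (flatten As) (flatten As) ->
    lg_tail n (map FPerm As)
| lgt_cons As i fs :
    lgreedy_braid n As ->
    greatest_br_ldiv n (flatten As) (flatten As ++ xg i :: fword fs) ->
    idx_ok n i ->
    ldiv n [:: xg i] (xg i :: fword fs) ->
    (forall j, (0 < j)%N -> (j < i)%N -> ~ ldiv n [:: xg j] (xg i :: fword fs)) ->
    lg_tail n fs ->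
    lg_tail n (map FPerm As ++ FX i :: fs).

Definition left_greedy_form n (W : seq letter) (t : int) (fs : seq frag) : Prop :=
  eqG n W (deltapow n t ++ fword fs) /\
  (forall t' V, pos_word n V -> eqG n W (deltapow n t' ++ V) -> (t' <= t)%R) /\
  ~ ldiv n (delta n) (fword fs) /\
  lg_tail n fs.

Definition rfrag_ok n (A P : seq letter) : Prop :=
  braid_word n A /\ ~ eqP_ n A [::] /\ brrdiv n A (delta n) /\ brrdiv n A P /\
  (forall C, braid_word n C -> brrdiv n C (delta n) -> brrdiv n C P -> brrdiv n C A).

(* As = [A_1; ...; A_r] with each A_j = gcd_right(Delta, A_1 ... A_j);
   the auxiliary function walks the list from the right. *)
Fixpoint rgreedy_aux n (revAs : seq (seq letter)) : Prop :=
  match revAs with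
  | [::] => True
  | A :: Bs => rfrag_ok n A (flatten (rev Bs) ++ A) /\ rgreedy_aux n Bs
  end.
Definition rgreedy_braid n (As : seq (seq letter)) : Prop := rgreedy_aux n (rev As).

Definition greatest_br_rdiv n (B U : seq letter) : Prop :=
  braid_word n B /\ rdiv n B U /\
  (forall C, braid_word n C -> rdiv n C U -> rdiv n C B).

Inductive rg_tail (n : nat) : seq frag -> Prop :=
| rgt_end As :
    rgreedy_braid n As ->
    greatest_br_rdiv n (flatten As) (flatten As) ->
    rg_tail n (map FPerm As)
| rgt_cons fs i As :
    rgreedy_braid n As ->
    greatest_br_rdiv n (flatten As) (fword fs ++ xg i :: flatten As) ->
    idx_ok n i ->
    rdiv n [:: xg i] (rcons (fword fs) (xg i)) ->
    (forall j, (0 < j)%N -> (j < i)%N -> ~ rdiv n [:: xg j] (rcons (fword fs) (xg i))) ->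
    rg_tail n fs ->
    rg_tail n (fs ++ FX i :: map FPerm As).

Definition right_greedy_form n (W : seq letter) (t : int) (fs : seq frag) : Prop :=
  eqG n W (fword fs ++ deltapow n t) /\
  (forall t' V, pos_word n V -> eqG n W (V ++ deltapow n t') -> (t' <= t)%R) /\
  ~ rdiv n (delta n) (fword fs) /\
  rg_tail n fs.

(* Main.v *)
Require Import Defs.
From mathcomp Require Import all_boot all_algebra zify.
From Stdlib Require Import Setoid Morphisms Classical.
From Stdlib Require List.

Set Implicit Arguments.
Unset Strict Implicit.
Unset Printing Implicit Defensive.

(* Call two letters g, h compatible if some defining relation reads g p = h q; the
   relation is then unique.  The key fact, in the style of Garside, is that in
   SB_n^+ an equality g a = h b forces g and h to be compatible (or equal), with
   a = p d and b = q d for some d.  By induction on length this follows from a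
   cube condition on triples of letters, which depends only on which of the three
   indices are equal or adjacent and is therefore a finite computation.  It yields
   left cancellation and a conditional lcm for braid words, hence greatest braid
   divisors.  The presentation is invariant under reversal of words, which gives
   right cancellation and exchanges left and right greedy forms.  Since Delta is
   quasi-central, left fractions Delta^-k P embed SB_n^+ in SB_n, so the power of
   Delta being fixed by maximality (it is bounded by degree), uniqueness reduces
   to SB_n^+, where each step of the greedy algorithm is forced by cancellation. *)

(* The congruence of the presentation and its length invariance *)
#[local] Hint Resolve sbeq_refl : core.

Instance sbeq_equivalence inv n : Equivalence (sbeq inv n).
Proof.
split; first by move=> u; apply: sbeq_refl.
- by move=> u v; apply: sbeq_sym.
- by move=> u v w; apply: sbeq_trans.
Qed.

Lemma sbeq_ctx inv n a b u v : sbeq inv n u v -> sbeq inv n (a ++ u ++ b) (a ++ v ++ b).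
Proof.
move=> uv; elim: uv a b => {u v} [a b u v uv|u|u v _ IH|u v w _ IH1 _ IH2] c d.
- by rewrite -!catA !(catA c a); apply: sbeq_step.
- exact: sbeq_refl.
- exact/sbeq_sym/IH.
- exact: sbeq_trans (IH1 c d) (IH2 c d).
Qed.

Instance cat_sbeq inv n :
  Proper (sbeq inv n ==> sbeq inv n ==> sbeq inv n) (@cat letter).
Proof.
move=> u u' uu' v v' vv'; apply: (sbeq_trans (v := u' ++ v)).
  exact: (sbeq_ctx [::] v uu').
by have := sbeq_ctx u' [::] vv'; rewrite !cats0.
Qed.

Instance cons_sbeq inv n g : Proper (sbeq inv n ==> sbeq inv n) (cons g).
Proof. by move=> u v uv; apply: (cat_sbeq (sbeq_refl inv n [:: g]) uv). Qed.

Lemma sbeq_rel inv n u v : sbrel inv n u v -> sbeq inv n u v.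
Proof. by move=> uv; have := sbeq_step [::] [::] uv; rewrite !cats0. Qed.

(** All relations of SB_n^+ are homogeneous; inductions on word length and the antisymmetry of
    divisibility rest on this. *)
Lemma sbeq_size n u v : sbeq false n u v -> size u = size v.
Proof.
elim=> // {u v} [a b u v uv|u v w _ -> _ ->] //.
by rewrite !size_cat; case: uv.
Qed.

Lemma sbeq_nil n u : sbeq false n u [::] -> u = [::].
Proof. by move/sbeq_size/size0nil. Qed.

(** * Common multiples of two letters *)

(** [sbrel] is oriented, while [g] and [h] have to play symmetric roles. *)
Definition proper_rel n g h p q :=
  sbrel false n (g :: p) (h :: q) \/ sbrel false n (h :: q) (g :: p).

Definition complement n g h p q :=
  (g = h /\ p = [::] /\ q = [::]) \/ proper_rel n g h p q.

(** The bound restricts the property to words of length at most [N], so that it can serve as its own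
    induction hypothesis. *)
Definition refines n N := forall g a h b, (size a < N)%N ->
  sbeq false n (g :: a) (h :: b) ->
  exists p q d, [/\ complement n g h p q, sbeq false n a (p ++ d)
                  & sbeq false n b (q ++ d)].

Definition adj (i j : nat) := (j == i.+1) || (i == j.+1).
Definition ok n i := (0 < i)%N && (i < n)%N.

(* A coded letter [(b, a)] is x (if [b]) or sigma with an abstract index [a];
   [E] and [A] decide equality and adjacency of indices. *)
Definition code := (bool * nat)%type.

(** * Word reversing on coded letters and the cube condition *)

Section Reversing.
Variables (E A : nat -> nat -> bool).

(** The complement of [g] towards [h]: [g] followed by [theta g h] equals [h] followed by
    [theta h g]. [None] marks two x with adjacent indices, for which there is no relation. *)
Definition theta (g h : code) : option (seq code) :=
  if (g.1 == h.1) && E g.2 h.2 then Some [::]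
  else if A g.2 h.2 then
    if g.1 && h.1 then None else Some [:: (false, h.2); (h.1, g.2)]
  else Some [:: h].

Inductive verdict := Stuck | Disjoint | Lcm of seq code & seq code.

(* Right reversing of [u] against [v] with fuel [m]: [Lcm u' v'] means that
   u v' = v u' is their least common right multiple. *)
Fixpoint reversing (m : nat) (u v : seq code) : verdict :=
  match m, u, v with
  | _, _, [::] => Lcm u [::]
  | _, [::], _ => Lcm [::] v
  | 0, _, _ => Stuck
  | m'.+1, g :: u', h :: v' =>
    match theta g h, theta h g with
    | Some p, Some q =>
      match reversing m' u' p with
      | Lcm u1 p1 =>
        match reversing m' v' (q ++ u1) with
        | Lcm v1 w1 => Lcm w1 (p1 ++ v1)
        | r => r
        end
      | r => r
      end
    | _, _ => Disjoint
    end
  end.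

(** A common multiple of [g], [k] and [h], built through [k] as g p e = k q e = k q' f = h r' f, has
    to factor through g s = h s'. If it exists, incompatible [g] and [h] count as failure, and so
    does exhausted fuel. *)
Definition cube (g k h : code) : bool :=
  match theta g k, theta k g, theta k h, theta h k with
  | Some p, Some q, Some q', Some r' =>
    match reversing 20 q q' with
    | Stuck => false
    | Disjoint => true
    | Lcm f e =>
      match theta g h, theta h g with
      | Some s, Some s' =>
        match reversing 20 (p ++ e) s with
        | Lcm r [::] =>
          match reversing 20 (r' ++ f) (s' ++ r) with
          | Lcm [::] [::] => true
          | _ => false
          end
        | _ => false
        end
      | _, _ => false
      end
    end
  | _, _, _, _ => true
  end.

End Reversing.

(** A symmetric relation on three abstract indices, given by its diagonal value and its off-diagonal
    entries; arguments above 2 count as 2. *)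
Definition mat (d m01 m02 m12 : bool) (a b : nat) : bool :=
  match a, b with
  | 0, 0 => d
  | 0, 1 | 1, 0 => m01
  | 0, _ | _, 0 => m02
  | 1, 1 => d
  | 1, _ | _, 1 => m12
  | _, _ => d
  end.

(* The triangle is excluded because indices are the vertices of a path. *)
Lemma cube_holds (e01 e02 e12 a01 a02 a12 tg tk th : bool) :
  (e01 ==> (e02 == e12) && (a02 == a12)) ->
  (e02 ==> (e01 == e12) && (a01 == a12)) ->
  (e12 ==> (e01 == e02) && (a01 == a02)) ->
  ~~ (e01 && a01) -> ~~ (e02 && a02) -> ~~ (e12 && a12) ->
  ~~ [&& a01, a02 & a12] ->
  cube (mat true e01 e02 e12) (mat false a01 a02 a12) (tg, 0) (tk, 1) (th, 2).
Proof.
case: e01; case: e02; case: e12; case: a01; case: a02; case: a12;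
by case: tg; case: tk; case: th; vm_compute.
Qed.

(** * Soundness and minimality of reversing *)

Section Soundness.
Variables (n : nat) (E A : nat -> nat -> bool) (rho : nat -> nat).
Hypothesis E_rho : forall a b, E a b = (rho a == rho b).
Hypothesis A_rho : forall a b, A a b = adj (rho a) (rho b).
Hypothesis ok_rho : forall a, ok n (rho a).

Definition decode (g : code) : letter := if g.1 then xg (rho g.2) else sg (rho g.2).

Lemma idx_rho a : idx_ok n (rho a).
Proof. by have /andP := ok_rho a. Qed.

Lemma theta_complement g h p q :
  theta E A g h = Some p -> theta E A h g = Some q ->
  complement n (decode g) (decode h) (map decode p) (map decode q).
Proof.
rewrite /theta !E_rho !A_rho; case: g h => [b i] [c j] /=.
have [oi oj] := (idx_rho i, idx_rho j).
have adjC : adj (rho j) (rho i) = adj (rho i) (rho j) by rewrite /adj orbC.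
rewrite adjC (eq_sym c) (eq_sym (rho j)).
case: andP => [[/eqP-> /eqP ij] [<-] [<-]|neq].
  by left; rewrite /decode /= ij.
case: ifP => [/orP[] /eqP ij|/norP[/eqP ij /eqP ji]].
- case: b c neq => [] [] //= neq [<-] [<-]; right;
    rewrite /decode /= ij in oj *;
    by [left; constructor | right; constructor].
- case: b c neq => [] [] //= neq [<-] [<-]; right;
    rewrite /decode /= ij in oi *;
    by [left; constructor | right; constructor].
- case: b c neq => [] [] //= neq [<-] [<-]; right; rewrite /decode /=;
    try have neq' : rho i <> rho j by [move=> e; apply: neq; rewrite e eqxx].
  + left; apply: r_xx => //; lia.
  + left; exact: r_xs.
  + right; apply: r_xs => //.
  + left; apply: r_ss => //; lia.
Qed.

Definition coded g h p q :=
  exists p' q', [/\ theta E A g h = Some p', theta E A h g = Some q',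
                 p = map decode p' & q = map decode q'].

(** The two first letters determine the rest of a defining relation, and [theta] recovers it.
    Uniqueness of complements rests on this. *)
Lemma coded_sbrel g h p q :
  sbrel false n (decode g :: p) (decode h :: q) -> coded g h p q.
Proof.
have far i j : (i.+1 < j \/ j.+1 < i)%N -> (i == j) = false /\ adj i j = false.
  by rewrite /adj; lia.
have adjC i j : adj j i = adj i j by rewrite /adj orbC.
have adjS i : adj i i.+1 by rewrite /adj eqxx.
have neqS i : (i == i.+1) = false by lia.
rewrite /coded /theta !E_rho !A_rho; case: g h => [b i] [c j] /=.
rewrite (eq_sym c) (eq_sym (rho j)) (adjC (rho i)) /decode /=.
move Eu: (_ :: p) => u; move Ev: (_ :: q) => v uv.
case: uv Eu Ev => {u v} [k l _ _ kl|k l _ _ kl|k l _ _ kl lk|k _ _|k _ _|k _ _|k|k] //;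
  case: b; case: c => //= - [ek ->] [el ->]; subst.
- by have [-> ->] := far _ _ kl; exists [:: (false, j)], [:: (false, i)].
- by have [-> ->] := far _ _ kl; exists [:: (true, j)], [:: (true, i)].
- have -> : adj (rho i) (rho j) = false by rewrite /adj; apply/norP; split; apply/eqP.
  by exists [:: (false, j)], [:: (true, i)].
- rewrite el neqS adjS; exists [:: (false, j); (false, i)], [:: (false, i); (false, j)].
  by rewrite /= el.
- rewrite el adjS; exists [:: (false, j); (true, i)], [:: (false, i); (false, j)].
  by rewrite /= el.
- rewrite ek (adjC (rho j)) adjS; exists [:: (false, j); (true, i)], [:: (false, i); (false, j)].
  by rewrite /= ek.
Qed.

Lemma complement_theta g h p q : complement n (decode g) (decode h) p q -> coded g h p q.
Proof.
case=> [[gh [-> ->]]|[/coded_sbrel //|/coded_sbrel [q' [p' [? ? -> ->]]]]].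
- exists [::], [::]; case: g h gh => [b i] [c j]; rewrite /decode /theta !E_rho /=.
  by case: b c => [] [] //= [->]; rewrite eqxx.
- by exists p', q'.
Qed.

Lemma complement_sbeq g h p q : complement n g h p q -> sbeq false n (g :: p) (h :: q).
Proof.
by case=> [[-> [-> ->]]|[/sbeq_rel|/sbeq_rel/sbeq_sym]] //; apply: sbeq_refl.
Qed.

Notation words := (map decode).

Lemma reversing_common_multiple m u v u' v' :
  reversing E A m u v = Lcm u' v' ->
  sbeq false n (words u ++ words v') (words v ++ words u').
Proof.
elim: m u v u' v' => [|m IH] [|g u] [|h v] u' v' //= ;
  try by [case=> <- <-; rewrite /= ?cats0; apply: sbeq_refl].
case gh: theta => [p|//]; case hg: theta => [q|//].
case up: reversing => [||u1 p1] //; case vq: reversing => [||v1 w1] // [<- <-].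
have := complement_sbeq (theta_complement gh hg).
move/IH: up => up; move/IH: vq => vq H.
rewrite !map_cat in vq *; rewrite catA up vq -!catA.
exact: (cat_sbeq H (sbeq_refl _ _ _)).
Qed.

(** Minimality: a common multiple of length at most [N] factors through the one found by reversing,
    and [Disjoint] words have none. [Stuck] claims nothing. *)
Lemma reversing_divides N m u v e f :
  refines n N -> (size (words u ++ e) <= N)%N ->
  sbeq false n (words u ++ e) (words v ++ f) ->
  match reversing E A m u v with
  | Stuck => True
  | Disjoint => False
  | Lcm u' v' => exists d, sbeq false n e (words v' ++ d) /\ sbeq false n f (words u' ++ d)
  end.
Proof.
move=> HN; elim: m u v e f => [|m IH] [|g u] [|h v] e f //=.
- by move=> _ ef; exists f; split; [|reflexivity].
- by move=> _ ef; exists f; split; [|reflexivity].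
- by move=> _ ef; exists e; split; [reflexivity|symmetry].
- by move=> _ ef; exists f; split; [|reflexivity].
- by move=> _ ef; exists f; split; [|reflexivity].
- by move=> _ ef; exists e; split; [reflexivity|symmetry].
move=> sz uv; have sz' := sbeq_size uv.
have [p0 [q0 [d [gh ue vf]]]] := HN _ _ _ _ sz uv.
have [p [q [-> -> ep eq]]] := complement_theta gh; rewrite {}ep {}eq in ue vf.
have se : (size (words v ++ f) <= N)%N by move: sz sz' => /=; lia.
have := IH _ _ _ _ (ltnW sz) ue; case: reversing => [||u1 p1] // [d1 [e1 d1E]].
have vf' : sbeq false n (words v ++ f) (words (q ++ u1) ++ d1).
  by rewrite vf d1E map_cat catA.
have := IH _ _ _ _ se vf'; case: reversing => [||v1 w1] // [d2 [fE d1E2]].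
by exists d2; split=> //; rewrite e1 d1E2 map_cat catA.
Qed.

End Soundness.

(** * The refinement property and left cancellation *)

Lemma complement_sym n g h p q : complement n g h p q -> complement n h g q p.
Proof. by case=> [[-> [-> ->]]|[]]; [left|right; right|right; left]. Qed.

Lemma sbrel_decode n g p h q : sbrel false n (g :: p) (h :: q) ->
  exists b c i j, [/\ g = (if b then xg i else sg i), h = (if c then xg j else sg j),
                   ok n i & ok n j].
Proof.
move Eu: (g :: p) => u; move Ev: (h :: q) => v uv.
have okP i : idx_ok n i -> ok n i by case=> i0 ni; apply/andP.
case: uv Eu Ev => {u v} [i j oi oj _|i j oi oj _|i j oi oj _ _|i oi oj|i oi oj|i oi oj|//|//]
  [-> _] [-> _].
- by exists false, false, i, j; split; auto.
- by exists true, true, i, j; split; auto.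
- by exists true, false, i, j; split; auto.
- by exists false, false, i, i.+1; split; auto.
- by exists false, true, i, i.+1; split; auto.
- by exists false, true, i.+1, i; split; auto.
Qed.

Lemma proper_decode n g h p q : proper_rel n g h p q ->
  exists b c i j, [/\ g = (if b then xg i else sg i), h = (if c then xg j else sg j),
                   ok n i & ok n j].
Proof.
case=> /sbrel_decode; first by [].
by case=> b [c [i [j [? ? ? ?]]]]; exists c, b, j, i.
Qed.

Lemma refines_trans n N g k h p q q' r' a b e f :
  refines n N -> (size (q ++ e) <= N)%N ->
  complement n g k p q -> complement n k h q' r' ->
  sbeq false n (q ++ e) (q' ++ f) ->
  sbeq false n a (p ++ e) -> sbeq false n b (r' ++ f) ->
  exists s s' d, [/\ complement n g h s s', sbeq false n a (s ++ d)
                  & sbeq false n b (s' ++ d)].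
Proof.
move=> HN sz gk kh ef ae bf.
(* If [g = k] or [k = h], one pair of complements is empty and the other pair is the answer. *)
case: (gk) => [[gkE [pE qE]]|/proper_decode gk'].
  subst; exists q', r', f; split=> //.
  by rewrite ae -ef.
case: (kh) => [[khE [pE qE]]|/proper_decode kh'].
  subst; exists p, q, e; split=> //.
  by rewrite bf ef.
case: gk' => tg [tk [i [j [gE kE oi oj]]]].
case: kh' => _ [th [_ [l [_ hE _ ol]]]].
(* The indices of [g], [k], [h] become 0, 1, 2, and the matrices record which of them are equal or
   adjacent, so that the finite check applies. *)
pose rho a := match a with 0 => i | 1 => j | _ => l end.
pose E := mat true (i == j) (i == l) (j == l).
pose A := mat false (adj i j) (adj i l) (adj j l).
have E_rho a' b' : E a' b' = (rho a' == rho b').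
  by case: a' b' => [|[|a']] [|[|b']] //=; rewrite ?eqxx // eq_sym.
have adjC x y : adj x y = adj y x by rewrite /adj orbC.
have adjN x : adj x x = false by rewrite /adj; lia.
have A_rho a' b' : A a' b' = adj (rho a') (rho b').
  by case: a' b' => [|[|a']] [|[|b']] //=; rewrite ?adjN // adjC.
have ok_rho a' : ok n (rho a') by case: a' => [|[|a']].
have cub : cube E A (tg, 0) (tk, 1) (th, 2).
  by apply: cube_holds; rewrite /adj; lia.
have gE' : g = decode rho (tg, 0) by [].
have kE' : k = decode rho (tk, 1) by [].
have hE' : h = decode rho (th, 2) by [].
move: gk kh; rewrite gE' kE' hE'.
case/(complement_theta E_rho A_rho) => pc [qc [gkc kgc pE qE]].
case/(complement_theta E_rho A_rho) => qc' [rc [khc hkc qE' rE]]; subst p q q' r'.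
move: cub; rewrite /cube gkc kgc khc hkc.
(* [Disjoint] is impossible here, since [q ++ e] and [q' ++ f] agree. *)
have := reversing_divides E_rho A_rho 20 HN sz ef.
case: reversing => [//|//|f' e'] [d [eE fE]].
case gh: (theta E A (tg, 0) (th, 2)) => [s|//].
case hg: (theta E A (th, 2) (tg, 0)) => [s'|//].
case R1: reversing => [||r [|//]] //; case R2: reversing => [||[|//] [|//]] // _.
have := reversing_common_multiple E_rho A_rho ok_rho R1.
have := reversing_common_multiple E_rho A_rho ok_rho R2.
rewrite /= !cats0 !map_cat => R2' R1'.
exists (map (decode rho) s), (map (decode rho) s'), (map (decode rho) r ++ d); split.
- exact: (theta_complement E_rho A_rho ok_rho gh hg).
- by rewrite ae eE catA R1' catA.
- by rewrite bf fE catA R2' -catA.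
Qed.

(** The outer induction is on length, the inner one on the derivation; the alternative [u = v]
    covers reflexivity and thereby empty words. *)
Lemma refines_all n N : refines n N.
Proof.
elim: N => [//|N IH].
suff H u v : sbeq false n u v -> (size u <= N.+1)%N -> u = v \/
    exists g a h b p q d, [/\ u = g :: a, v = h :: b, complement n g h p q,
      sbeq false n a (p ++ d) & sbeq false n b (q ++ d)].
  move=> g a h b sz gh; case: (H _ _ gh sz) => [[-> ->]|].
    by exists [::], [::], b; split=> //; left.
  by case=> g' [a' [h' [b' [p [q [d [[-> ->] [-> ->] ? ? ?]]]]]]]; exists p, q, d.
(* A relation applies either at the front, where it is itself the complement, or behind a first
   letter [g], where both heads agree. *)
elim=> {u v} [[|g a] b u v uv|u|u v uv IHuv|u v w uv IHuv vw IHvw].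
- rewrite !cat0s; case: u v uv => [|g p] [|h q] uv sz; try by inversion uv.
  by right; exists g, (p ++ b), h, (q ++ b), p, q, b; split=> //; right; left.
- move=> _; right; exists g, (a ++ u ++ b), g, (a ++ v ++ b), [::], [::], (a ++ v ++ b).
  by split=> //; [left|apply: sbeq_step].
- by left.
- rewrite -(sbeq_size uv) => /IHuv [->|]; first by left.
  case=> g [a [h [b [p [q [d [-> -> gh ad bd]]]]]]]; right.
  by exists h, b, g, a, q, p, d; split=> //; apply: complement_sym.
- move=> sz; case: (IHuv sz) => [->|]; first by rewrite (sbeq_size uv) in sz; auto.
  rewrite (sbeq_size uv) in sz.
  case=> g [a [k [c [p [q [e [-> vE gk ae ce]]]]]]].
  case: (IHvw sz) => [<-|]; first by right; exists g, a, k, c, p, q, e.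
  case=> k' [c' [h [b [q' [r' [f [vE' -> kh cf bf]]]]]]].
  move: vE' kh cf sz; rewrite vE => - [<- <-] kh cf sz; right.
  (* Dropping [k] from the middle word leaves length at most [N], within reach of the outer
     hypothesis. *)
  have [||s [s' [d [gh ad bd]]]] := refines_trans IH _ gk kh _ ae bf.
  + by rewrite -(sbeq_size ce).
  + by rewrite -ce.
  + by exists g, a, h, b, s, s', d.
Qed.

Lemma common_multiple n g a h b : sbeq false n (g :: a) (h :: b) ->
  exists p q d, [/\ complement n g h p q, sbeq false n a (p ++ d)
                  & sbeq false n b (q ++ d)].
Proof. exact: (refines_all (ltnSn _)). Qed.

Lemma complement_det n g h p q p' q' :
  complement n g h p q -> complement n g h p' q' -> p = p' /\ q = q'.
Proof.
(* Unless both complements are trivial, a proper relation puts the indices in range; both letters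
   can then be coded, and [theta] is a function. *)
suff H : proper_rel n g h p q \/ proper_rel n g h p' q' ->
    complement n g h p q -> complement n g h p' q' -> p = p' /\ q = q'.
  move=> c c'; case: (c) => [[_ [pE qE]]|?]; case: (c') => [[_ [pE' qE']]|?];
    by [subst|apply: H => //; auto].
move=> gh.
have {gh} [b [c [i [j [gE hE oi oj]]]]] : exists b c i j,
    [/\ g = (if b then xg i else sg i), h = (if c then xg j else sg j), ok n i & ok n j].
  by case: gh => /proper_decode.
pose rho a := if a is 0 then i else j.
have -> : g = decode rho (b, 0) by [].
have -> : h = decode rho (c, 1) by [].
have eE a a' : (rho a == rho a') = (rho a == rho a') by [].
have aE a a' : adj (rho a) (rho a') = adj (rho a) (rho a') by [].
case/(complement_theta eE aE) => [p1 [q1 [t1 t2 -> ->]]].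
case/(complement_theta eE aE) => [p2 [q2 [t3 t4 -> ->]]].
by move: t1 t2; rewrite t3 t4 => -[->] [->].
Qed.

Lemma complement_same n g p q : complement n g g p q -> p = [::] /\ q = [::].
Proof. by move/complement_det; apply; left. Qed.

Lemma cons_cancel n g a b : sbeq false n (g :: a) (g :: b) -> sbeq false n a b.
Proof.
by move/common_multiple=> [p [q [d [/complement_same [-> ->] -> ->]]]].
Qed.

Lemma cat_cancel_l n u a b : sbeq false n (u ++ a) (u ++ b) -> sbeq false n a b.
Proof. by elim: u => [//|g u IH] /cons_cancel. Qed.

(** * Reversal, divisibility and braid divisors *)

(** Reversal exchanges [r_sx1] with [r_sx2] and [r_inv1] with [r_inv2]; every other family is closed
    under it up to symmetry. *)
Lemma sbrel_rev inv n u v : sbrel inv n u v -> sbeq inv n (rev u) (rev v).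
Proof.
case=> [i j oi oj ij|i j oi oj ij|i j oi oj ij ji|i oi oj|i oi oj|i oi oj|i e oi|i e oi];
  try by apply/sbeq_rel; rewrite /rev /=; constructor.
all: by apply/sbeq_sym/sbeq_rel; rewrite /rev /=; constructor.
Qed.

Lemma sbeq_rev inv n u v : sbeq inv n u v -> sbeq inv n (rev u) (rev v).
Proof.
elim=> {u v} [a b u v /sbrel_rev uv|u|u v _ IH|u v w _ IH1 _ IH2] //.
- by rewrite !rev_cat uv.
- by symmetry.
- by rewrite IH1.
Qed.

Instance rev_sbeq inv n : Proper (sbeq inv n ==> sbeq inv n) (@rev letter).
Proof. by move=> u v; apply: sbeq_rev. Qed.

Lemma cat_cancel_r n u a b : sbeq false n (a ++ u) (b ++ u) -> sbeq false n a b.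
Proof.
move/sbeq_rev; rewrite !rev_cat => /cat_cancel_l /sbeq_rev.
by rewrite !revK.
Qed.

(** [valid_word], [pos_word] and [braid_word] are convertible to instances of this, so they share
    the closure lemmas. *)
Definition over (P : letter -> Prop) (w : seq letter) := forall l, List.In l w -> P l.

Lemma over_nil P : over P [::].
Proof. by []. Qed.

Lemma over_cons P g w : over P (g :: w) <-> P g /\ over P w.
Proof.
split=> [H|[Pg Pw] l [<-|/Pw]] //.
by split=> [|l lw]; [apply: H; left|apply: H; right].
Qed.

Lemma over_cat P u v : over P (u ++ v) <-> over P u /\ over P v.
Proof.
elim: u => [|g u IH] /=; first by split=> [?|[]//]; split=> //; exact: over_nil.
by rewrite !over_cons IH; tauto.
Qed.

Lemma over_rev P w : over P (rev w) <-> over P w.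
Proof.
elim: w => [//|g w IH].
rewrite rev_cons -cats1 over_cat IH !over_cons; have := @over_nil P; tauto.
Qed.

Lemma over_sub P Q w : (forall l, P l -> Q l) -> over P w -> over Q w.
Proof. by move=> PQ Pw l /Pw /PQ. Qed.

Lemma over_sbeq inv n P u v :
  (forall u v, sbrel inv n u v -> over P u <-> over P v) ->
  sbeq inv n u v -> over P u <-> over P v.
Proof.
move=> HP; elim=> {u v} [a b u v /HP uv|u|u v _ IH|u v w _ IH1 _ IH2] //.
- by rewrite !over_cat uv.
- by rewrite IH.
- by rewrite IH1.
Qed.

Lemma pos_word_sbeq n u v : sbeq false n u v -> pos_word n u <-> pos_word n v.
Proof.
apply: over_sbeq => {u v} u v; set P := (fun l => _).
have sP i : idx_ok n i -> P (sg i) by [].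
have xP i : idx_ok n i -> P (xg i) by [].
by case=> [i j|i j|i j|i|i|i|//|//] oi oj *; rewrite !over_cons; intuition.
Qed.

Lemma braid_word_sbeq n u v : sbeq false n u v -> braid_word n u <-> braid_word n v.
Proof.
apply: over_sbeq => {u v} u v; set P := (fun l => _).
have xP i : ~ P (xg i) by case.
have sP i : idx_ok n i -> P (sg i) by exists i.
by case=> [i j|i j|i j|i|i|i|//|//] oi oj *; rewrite !over_cons; intuition;
  exfalso; eapply xP; eassumption.
Qed.

Lemma braid_pos n w : braid_word n w -> pos_word n w.
Proof. by apply: over_sub => l [i oi ->]; split. Qed.

(** * Left divisibility, lcm and gcd of braid words *)

(** The cofactor is unconstrained. As the relations preserve positive words and braid words, this
    agrees with [ldiv] and [brldiv] on dividends of the respective kind. *)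
Definition divides n a b := exists c, sbeq false n (a ++ c) b.

Instance divides_sbeq n :
  Proper (sbeq false n ==> sbeq false n ==> iff) (divides n).
Proof. by move=> a a' aa' b b' bb'; split=> -[c]; exists c; [rewrite -aa' -bb'|rewrite aa' bb']. Qed.

Lemma ldivP n a b : pos_word n b -> ldiv n a b <-> divides n a b.
Proof.
move=> pb; split=> [[c _ ?]|[c ac]]; exists c => //.
by move/(pos_word_sbeq ac)/over_cat: pb => [].
Qed.

Lemma brldivP n a b : braid_word n b -> brldiv n a b <-> divides n a b.
Proof.
move=> pb; split=> [[c _ ?]|[c ac]]; exists c => //.
by move/(braid_word_sbeq ac)/over_cat: pb => [].
Qed.

Lemma divides_refl n a : divides n a a.
Proof. by exists [::]; rewrite cats0. Qed.

Lemma divides_cat n a b : divides n a (a ++ b).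
Proof. by exists b. Qed.

Lemma divides_nil n a : divides n [::] a.
Proof. by exists a. Qed.

Lemma divides_trans n a b c : divides n a b -> divides n b c -> divides n a c.
Proof. by case=> x ab [y bc]; exists (x ++ y); rewrite catA ab. Qed.

Lemma divides_size n a b : divides n a b -> (size a <= size b)%N.
Proof. by case=> c /sbeq_size <-; rewrite size_cat leq_addr. Qed.

Lemma divides_size_eq n a b : divides n a b -> (size b <= size a)%N -> sbeq false n a b.
Proof.
case=> c ab sz; move: (sbeq_size ab); rewrite size_cat => e.
have c0 : c = [::] by apply: size0nil; lia.
by rewrite -ab c0 cats0.
Qed.

Lemma divides_cat2l n u a b : divides n (u ++ a) (u ++ b) <-> divides n a b.
Proof.
split=> -[c H]; exists c; last by rewrite -catA H.
by apply: (cat_cancel_l (u := u)); rewrite catA.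
Qed.

Lemma divides_cons2 n g a b : divides n (g :: a) (g :: b) <-> divides n a b.
Proof. exact: (divides_cat2l n [:: g]). Qed.

Lemma complement_braid n i j p q : complement n (sg i) (sg j) p q -> braid_word n p.
Proof.
have sP k : idx_ok n k -> exists2 k', idx_ok n k' & sg k = sg k' by exists k.
case=> [[_ [-> _]]|[]] //; move E1: (_ :: p) => u; move E2: (_ :: q) => v uv;
  case: uv E1 E2 => {u v} [k l ok_k ok_l _|//|//|k ok_k ok_l|//|//|//|//] [_ ->] _;
  rewrite /braid_word -/(over _ _) !over_cons; have := over_nil; by intuition.
Qed.

(** The lcm is conditional on a common multiple [U], whose length drives the induction; its
    minimality holds against multiples in all of SB_n^+. *)
Lemma braid_lcm n U C C' : braid_word n C -> braid_word n C' ->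
  divides n C U -> divides n C' U ->
  exists D, [/\ braid_word n D, divides n C D, divides n C' D
    & forall V, divides n C V -> divides n C' V -> divides n D V].
Proof.
have [N] := ubnP (size U); elim: N U C C' => // N IH U [|g C] [|h C'] szU.
- by exists [::]; split=> //; apply: divides_refl.
- by exists (h :: C'); split=> //; [apply: divides_nil|apply: divides_refl].
- by exists (g :: C); split=> //; [apply: divides_refl|apply: divides_nil].
move=> bC bC' [a aU] [b bU].
have szU1 : (size (C ++ a) < N)%N by move: szU; rewrite -(sbeq_size aU).
have szU2 : (size (C' ++ b) < N)%N by move: szU; rewrite -(sbeq_size bU).
have [[i _ gE] bC1] := proj1 (over_cons _ _ _) bC.
have [[j _ hE] bC1'] := proj1 (over_cons _ _ _) bC'.
have [p [q [d [gh ap bq]]]] : exists p q d, [/\ complement n g h p q,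
    sbeq false n (C ++ a) (p ++ d) & sbeq false n (C' ++ b) (q ++ d)].
  by apply: common_multiple; rewrite -!cat_cons aU bU.
have bp : braid_word n p.
  by subst g h; apply: (complement_braid gh).
have pU : divides n p (C ++ a) by rewrite ap; apply: divides_cat.
(* [g :: D1] is the lcm of [g :: C] and g p = h q; it is rewritten next as [h :: q ++ D2]. *)
have [D1 [bD1 CD1 pD1 minD1]] := IH _ _ _ szU1 bC1 bp (divides_cat _ _ _) pU.
have gpq := complement_sbeq gh.
have [D2 D2E] : divides n (h :: q) (g :: D1) by rewrite -gpq divides_cons2.
have D1U : divides n (g :: D1) U.
  by rewrite -aU /= divides_cons2; apply: minD1 => //; apply: divides_cat.
have bD2 : braid_word n (q ++ D2).
  have : braid_word n (g :: D1).
    by apply/over_cons; split=> //; case/over_cons: bC.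
  by rewrite -(braid_word_sbeq D2E) => /over_cons [].
have D2U : divides n (q ++ D2) (C' ++ b).
  by rewrite -(divides_cons2 n h) -!cat_cons D2E bU.
(* It remains to take the lcm with [h :: C'], after removing the common first letter [h]. *)
have [D3 [bD3 C'D3 D2D3 minD3]] := IH _ _ _ szU2 bC1' bD2 (divides_cat _ _ _) D2U.
exists (h :: D3); split.
- by apply/over_cons; split=> //; case/over_cons: bC'.
- apply: (divides_trans (b := g :: D1)); first by rewrite divides_cons2.
  by rewrite -D2E /= divides_cons2.
- by rewrite divides_cons2.
move=> V [x xV] [y yV].
(* Inside any other common multiple [V] the complements are the same [p] and [q]. *)
have [p' [q' [e [gh' xe ye]]]] : exists p q d, [/\ complement n g h p q,
    sbeq false n (C ++ x) (p ++ d) & sbeq false n (C' ++ y) (q ++ d)].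
  by apply: common_multiple; rewrite -!cat_cons xV yV.
have [pp' qq'] := complement_det gh gh'; subst p' q'.
rewrite -yV /= divides_cons2; apply: minD3; first exact: divides_cat.
rewrite -(divides_cons2 n h) -!cat_cons D2E yV -xV /= divides_cons2.
by apply: minD1; [exact: divides_cat|rewrite xe; exact: divides_cat].
Qed.

Lemma ex_longest (P : seq letter -> Prop) N w0 :
  P w0 -> (forall w, P w -> (size w <= N)%N) ->
  exists2 w, P w & forall w', P w' -> (size w' <= size w)%N.
Proof.
move=> P0 bound; apply: NNPP => none.
have step k : exists2 w, P w & (k <= size w)%N.
  elim: k => [|k [w Pw kw]]; first by exists w0.
  apply: NNPP => nw; apply: none; exists w => // w' Pw'.
  rewrite leqNgt; apply/negP => lt; apply: nw; exists w' => //; lia.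
by have [w /bound] := step N.+1; lia.
Qed.

(** A longest common braid divisor absorbs any other one: their lcm is again a common divisor, hence
    no longer. *)
Lemma braid_gcd n U V : exists B, [/\ braid_word n B, divides n B U, divides n B V
  & forall C, braid_word n C -> divides n C U -> divides n C V -> divides n C B].
Proof.
have [||B [bB BU BV] maxB] := ex_longest (N := size U) (w0 := [::])
  (P := fun C => [/\ braid_word n C, divides n C U & divides n C V]).
- by split=> //; apply: divides_nil.
- by move=> w [_ /divides_size].
exists B; split=> // C bC CU CV.
have [D [bD BD CD minD]] := braid_lcm bB bC BU CU.
suff -> : sbeq false n B D by [].
by apply: (divides_size_eq BD); apply: maxB; split=> //; apply: minD.
Qed.

(** * The Garside element *)

(** sigma_i and x_i obey the same commutation and sliding rules past the sigmas, so both are treated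
    at once. *)
Definition gen (b : bool) (i : nat) : letter := if b then xg i else sg i.

Definition ascent (m : nat) : seq letter := [seq sg j | j <- iota 1 m].
(** The half twist on m + 1 strands; [delta n] is convertible to [twist n.-1]. *)
Definition twist (m : nat) : seq letter := flatten [seq ascent k | k <- rev (iota 1 m)].

Lemma ascentS m : ascent m.+1 = ascent m ++ [:: sg m.+1].
Proof. by rewrite /ascent -[in LHS](addn1 m) iotaD map_cat. Qed.

Lemma twistS m : twist m.+1 = ascent m.+1 ++ twist m.
Proof. by rewrite /twist -[in LHS](addn1 m) iotaD rev_cat. Qed.

Lemma ascent_braid n m : (m < n)%N -> braid_word n (ascent m).
Proof.
elim: m => [_|m IH mn]; first exact: over_nil.
rewrite ascentS; apply/over_cat; split; first by apply: IH; lia.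
by apply/over_cons; split; [exists m.+1 => //; split; lia|apply: over_nil].
Qed.

Lemma twist_braid n m : (m < n)%N -> braid_word n (twist m).
Proof.
elim: m => [_|m IH mn]; first exact: over_nil.
by rewrite twistS; apply/over_cat; split; [apply: ascent_braid|apply: IH; lia].
Qed.

Lemma gen_comm n b i j : idx_ok n i -> idx_ok n j -> (j.+1 < i)%N ->
  sbeq false n [:: gen b i; sg j] [:: sg j; gen b i].
Proof.
move=> oi oj ij; case: b; apply: sbeq_rel; first by apply: r_xs => //; lia.
by apply: r_ss; auto.
Qed.

Lemma gen_slide n b i w : idx_ok n i -> idx_ok n i.+1 ->
  sbeq false n (sg i :: sg i.+1 :: gen b i :: w) (gen b i.+1 :: sg i :: sg i.+1 :: w).
Proof.
move=> oi oi'; apply: (@cat_sbeq false n [:: _; _; _] [:: _; _; _] _ w w) => //.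
by case: b; apply: sbeq_rel; constructor.
Qed.

Lemma ascent_far n b i m : idx_ok n i -> (m.+1 < i)%N ->
  sbeq false n (ascent m ++ [:: gen b i]) (gen b i :: ascent m).
Proof.
move=> oi; elim: m => [//|m IH] mi.
have om : idx_ok n m.+1 by split; case: oi; lia.
rewrite ascentS -catA /= -(gen_comm b oi om mi).
by rewrite -cat1s catA IH; last lia.
Qed.

(** The letter commutes leftwards until it meets sigma_i sigma_{i+1}, slides through them with its
    index raised, and commutes with what remains. *)
Lemma ascent_gen n b i m : (0 < i)%N -> (i < m)%N -> (m < n)%N ->
  sbeq false n (ascent m ++ [:: gen b i]) (gen b i.+1 :: ascent m).
Proof.
move=> i0; elim: m => [//|m IH] im mn; rewrite ascentS -catA.
have [{}im|mi] := ltnP i m.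
  have -> : sbeq false n ([:: sg m.+1] ++ [:: gen b i]) ([:: gen b i] ++ [:: sg m.+1]).
    case: b {IH}; first by apply/sbeq_sym/sbeq_rel; apply: r_xs; split || idtac; lia.
    by apply: sbeq_rel; apply: r_ss; [split; lia|split; lia|right; lia].
  by rewrite catA IH //; lia.
have {mi im} mE : m = i by lia.
subst m; case: i i0 IH mn => // i _ _ mn; rewrite ascentS -catA /=.
have oi : idx_ok n i.+1 by split; lia.
have oi' : idx_ok n i.+2 by split; lia.
rewrite (gen_slide b [::] oi oi').
by rewrite -cat1s catA (ascent_far b oi' (ltnSn _)) /= -!catA.
Qed.

Lemma twist_far n b i m : idx_ok n i -> (m.+1 < i)%N ->
  sbeq false n (twist m ++ [:: gen b i]) (gen b i :: twist m).
Proof.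
move=> oi; elim: m => [//|m IH] mi; rewrite twistS -catA IH; last lia.
by rewrite -cat1s catA ascent_far.
Qed.

(** A second factorisation, with the longest row last and descending; it gives the palindromicity of
    the half twist and handles the top generator. *)
Lemma twist_split n m : (m.+1 < n)%N ->
  sbeq false n (twist m.+1) (twist m ++ rev (ascent m.+1)).
Proof.
elim: m => [//|m IH] mn; have om : idx_ok n m.+2 by split; lia.
have comm := twist_far false om (ltnSn _).
apply: (sbeq_trans (v := ascent m.+2 ++ twist m ++ rev (ascent m.+1))).
  by rewrite twistS IH //; lia.
rewrite (ascentS m.+1) rev_cat (twistS m) -!catA (catA (twist m)) comm.
by rewrite cat_cons.
Qed.

Lemma twist_rev n m : (m < n)%N -> sbeq false n (rev (twist m)) (twist m).
Proof.
elim: m => [//|m IH] mn; rewrite {1}twistS rev_cat IH; last lia.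
by rewrite -twist_split.
Qed.

Lemma twist_gen n b i m : (0 < i)%N -> (i <= m)%N -> (m < n)%N ->
  sbeq false n (twist m ++ [:: gen b i]) (gen b (m.+1 - i) :: twist m).
Proof.
elim: m i => [|m IH] i i0 im mn; first by lia.
have [{}im|mi] := ltnP i m.+1.
  rewrite twistS -catA IH //; try lia.
  rewrite -cat1s catA ascent_gen //; try lia.
  by have -> : ((m.+1 - i).+1 = m.+2 - i)%N by lia.
(* The top index is out of reach of [ascent_gen]; the descending factorisation is used instead. *)
have {mi im} -> : i = m.+1 by lia.
have -> : (m.+2 - m.+1 = 1)%N by lia.
case: m IH mn => [_ mn|m IH mn].
  case: b => //; apply/sbeq_sym/sbeq_rel; apply: r_xs => //; split; lia.
rewrite (twist_split mn) -catA.
have -> : sbeq false n (rev (ascent m.+2) ++ [:: gen b m.+2]) (gen b m.+1 :: rev (ascent m.+2)).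
  have := sbeq_rev (@ascent_gen n b m.+1 m.+2 isT (ltnSn _) mn).
  by rewrite -[gen _ _ :: ascent _]cat1s !rev_cat => H; exact/sbeq_sym/H.
rewrite -cat1s catA IH //; try lia.
by have -> : (m.+2 - m.+1 = 1)%N by lia.
Qed.

Lemma twist_sigma n i m : (0 < i)%N -> (i <= m)%N -> (m < n)%N ->
  {c | sbeq false n (sg i :: c) (twist m)}.
Proof.
elim: m i => [|m IH] [//|i] _ im mn; first by lia.
case: i im => [|i] im.
  by exists (behead (ascent m.+1) ++ twist m); rewrite twistS.
have [|||c cE] := IH i.+1; try lia.
exists (ascent m.+1 ++ c).
by rewrite twistS -cE -(cat1s _ c) catA (ascent_gen false) //; lia.
Qed.

(** The effect of conjugation by Delta on indices. *)
Definition flip_letter n (l : letter) : letter :=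
  match l with sg i => sg (n - i) | sgi i => sgi (n - i) | xg i => xg (n - i) end.
Definition flip n := map (flip_letter n).

Section Delta.
Variables (n : nat) (n_ge2 : (2 <= n)%N).

Lemma deltaE : delta n = twist n.-1.
Proof. by []. Qed.

Lemma delta_braid : braid_word n (delta n).
Proof. by apply: twist_braid; lia. Qed.

Lemma delta_rev : sbeq false n (rev (delta n)) (delta n).
Proof. by apply: twist_rev; lia. Qed.

Lemma delta_size : (0 < size (delta n))%N.
Proof. by rewrite deltaE; case: n n_ge2 => [|[|m]] // _; rewrite twistS. Qed.

Lemma delta_sigma i : idx_ok n i -> {c | sbeq false n (sg i :: c) (delta n)}.
Proof. by case=> i0 ni; apply: twist_sigma; lia. Qed.

(** The witness precedes the hypothesis on [i], so that it yields a total function of [i]; indices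
    out of range get the empty word. *)
Lemma delta_sigma_r i : {c | idx_ok n i -> sbeq false n (c ++ [:: sg i]) (delta n)}.
Proof.
case oi: (ok n i); last by exists [::] => -[i0 ni]; move: oi; rewrite /ok i0 ni.
have [c cE] : {c | sbeq false n (sg i :: c) (delta n)}.
  by apply: delta_sigma; case/andP: oi.
by exists (rev c) => _; rewrite -delta_rev -cE rev_cons -cats1.
Qed.

Lemma delta_flip w : pos_word n w -> sbeq false n (delta n ++ w) (flip n w ++ delta n).
Proof.
elim: w => [_|l w IH /over_cons [[ol posl] pw]]; first by rewrite cats0.
have step b i : idx_ok n i ->
    sbeq false n (delta n ++ gen b i :: w) (gen b (n - i) :: flip n w ++ delta n).
  case=> i0 ni; rewrite -(cat1s _ w) catA deltaE twist_gen //; try lia.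
  by rewrite prednK; [rewrite cat_cons -deltaE IH|lia].
case: l ol posl => i /= ol posl; [exact: (step false)| |exact: (step true)].
by case: (posl i).
Qed.

End Delta.

Lemma flip_idx n i : idx_ok n i -> idx_ok n (n - i).
Proof. by case; split; lia. Qed.

Lemma flip_pos n w : pos_word n w -> pos_word n (flip n w).
Proof.
elim: w => [_|l w IH /over_cons [[ol posl] pw]]; first exact: over_nil.
apply/over_cons; split; last exact: IH.
case: l ol posl => i /= /flip_idx oi posl; split => // k e.
by case: (posl i).
Qed.

Lemma flip_cat n u v : flip n (u ++ v) = flip n u ++ flip n v.
Proof. exact: map_cat. Qed.

Lemma flip_sbrel n u v : sbrel false n u v -> sbeq false n (flip n u) (flip n v).
Proof.
have nS i : idx_ok n i.+1 -> n - i = (n - i.+1).+1 by case; lia.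
case=> [i j oi oj ij|i j oi oj ij|i j oi oj ij ji|i oi oj|i oi oj|i oi oj|//|//] /=;
  (have oi' := flip_idx oi); (have oj' := flip_idx oj).
- by apply: sbeq_rel; apply: r_ss => //; case: oi oj => ? ? [? ?]; lia.
- by apply: sbeq_rel; apply: r_xx => //; case: oi oj => ? ? [? ?]; lia.
- by apply: sbeq_rel; apply: r_xs => //; case: oi oj => ? ? [? ?]; lia.
- rewrite (nS i oj) in oi' *; by apply/sbeq_sym/sbeq_rel; constructor.
- rewrite (nS i oj) in oi' *; by apply/sbeq_rel; constructor.
- rewrite (nS i oj) in oi' *; by apply/sbeq_rel; constructor.
Qed.

Lemma flip_sbeq n u v : sbeq false n u v -> sbeq false n (flip n u) (flip n v).
Proof.
elim=> {u v} [a b u v /flip_sbrel uv|u|u v _ IH|u v w _ IH1 _ IH2] //.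
- by rewrite !flip_cat uv.
- by symmetry.
- by rewrite IH1.
Qed.

(** * Embedding of the positive monoid *)

Section Fractions.
Variables (n : nat) (n_ge2 : (2 <= n)%N).

Definition delta_cofactor i := sval (delta_sigma_r n_ge2 i).

Lemma delta_cofactorP i : idx_ok n i -> sbeq false n (delta_cofactor i ++ [:: sg i]) (delta n).
Proof. exact: svalP (delta_sigma_r n_ge2 i). Qed.

(** If c sigma_i = Delta, then the inverse of sigma_i is Delta^-1 c; [num] and [den] record this
    fraction. *)
Definition num (l : letter) : seq letter :=
  if ~~ ok n (lidx l) then [::] else if l is sgi i then delta_cofactor i else [:: l].
Definition den (l : letter) : nat :=
  if l is sgi i then nat_of_bool (ok n i) else 0.

(* The pair [(k, P)] stands for Delta^-k P; letters with an index out of range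
   act trivially. *)
Definition fraction : Type := (nat * seq letter)%type.
Definition flips k := iter k (flip n).
(** Left multiplication of Delta^-k P by a letter: its numerator is flipped k times on its way past
    Delta^-k. *)
Definition frac_cons (l : letter) (x : fraction) : fraction :=
  (x.1 + den l, flips x.1 (num l) ++ x.2)%N.
Definition frac (w : seq letter) : fraction := foldr frac_cons (0, [::]) w.
Definition dpow k := flatten (nseq k (delta n)).
(** Cross multiplication by powers of Delta, which commute with each other. *)
Definition frac_eq (x y : fraction) := sbeq false n (dpow y.1 ++ x.2) (dpow x.1 ++ y.2).

Lemma dpowD k l : dpow (k + l) = dpow k ++ dpow l.
Proof. by rewrite /dpow nseqD flatten_cat. Qed.

Lemma idx_okP i : ok n i -> idx_ok n i.
Proof. by case/andP. Qed.

Lemma num_pos l : pos_word n (num l).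
Proof.
rewrite /num; case: ifP => [_|/negbFE ol]; first exact: over_nil.
case: l ol => i /idx_okP oi /=.
- by apply/over_cons; split=> //; apply: over_nil.
- have : pos_word n (delta_cofactor i ++ [:: sg i]).
    by apply/(pos_word_sbeq (delta_cofactorP oi))/braid_pos/delta_braid.
  by move/over_cat => [].
- by apply/over_cons; split=> //; apply: over_nil.
Qed.

Lemma flips_pos k w : pos_word n w -> pos_word n (flips k w).
Proof. by elim: k => [//|k IH] /IH /flip_pos. Qed.

Lemma flips_sbeq k u v : sbeq false n u v -> sbeq false n (flips k u) (flips k v).
Proof. by elim: k => [//|k IH] /IH /flip_sbeq. Qed.

Lemma flips_cat k u v : flips k (u ++ v) = flips k u ++ flips k v.
Proof. by elim: k => [//|k IH] /=; rewrite IH flip_cat. Qed.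

Lemma flipsD k l w : flips (k + l) w = flips k (flips l w).
Proof. exact: iterD. Qed.

Lemma dpow_flips k w : pos_word n w -> sbeq false n (dpow k ++ w) (flips k w ++ dpow k).
Proof.
elim: k => [|k IH] pw; first by rewrite /= cats0.
rewrite /dpow /= -/(dpow k) -catA IH // catA delta_flip //; last exact: flips_pos.
by rewrite catA.
Qed.

Lemma flip_delta : sbeq false n (flip n (delta n)) (delta n).
Proof.
apply: (cat_cancel_r (u := delta n)).
by rewrite -delta_flip //; apply/braid_pos/delta_braid.
Qed.

Lemma flips_delta k : sbeq false n (flips k (delta n)) (delta n).
Proof. by elim: k => [//|k IH]; rewrite /= (flip_sbeq IH) flip_delta. Qed.

Lemma frac_eq_refl x : frac_eq x x.
Proof. exact: sbeq_refl. Qed.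

Lemma frac_eq_sym x y : frac_eq x y -> frac_eq y x.
Proof. exact: sbeq_sym. Qed.

Lemma frac_eq_trans x y z : frac_eq x y -> frac_eq y z -> frac_eq x z.
Proof.
rewrite /frac_eq => xy yz; apply: (cat_cancel_l (u := dpow y.1)).
rewrite !catA -!dpowD (addnC y.1) dpowD -catA xy catA -dpowD (addnC z.1) dpowD -catA yz.
by rewrite catA -dpowD addnC.
Qed.

Lemma frac_cons_eq l x y : frac_eq x y -> frac_eq (frac_cons l x) (frac_cons l y).
Proof.
have pl := @num_pos l; case: x y => [k P] [m Q]; rewrite /frac_eq /frac_cons /= => H.
rewrite (addnC m) (addnC k) !dpowD -!catA (catA (dpow m)) (catA (dpow k)).
rewrite (dpow_flips m (@flips_pos k _ pl)) (dpow_flips k (@flips_pos m _ pl)).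
by rewrite -!flipsD -!catA H addnC.
Qed.

Lemma frac_pos w x : pos_word n w ->
  foldr frac_cons x w = (x.1, flips x.1 w ++ x.2).
Proof.
elim: w => [_|l w IH /over_cons [[[l0 ln] posl] pw]].
  by case: x => k P /=; have -> : flips k [::] = [::] by elim: k => //= k ->.
rewrite /= IH // /frac_cons /num /ok l0 ln /= -[l :: w]cat1s flips_cat -catA.
by case: l posl {l0 ln} => i posl; rewrite ?addn0 //; case: (posl i).
Qed.

Lemma sbrel_pos u v : sbrel false n u v -> pos_word n u /\ pos_word n v.
Proof.
have sP i : idx_ok n i -> idx_ok n (lidx (sg i)) /\ (forall j, sg i <> sgi j) by [].
have xP i : idx_ok n i -> idx_ok n (lidx (xg i)) /\ (forall j, xg i <> sgi j) by [].
by case=> [i j|i j|i j|i|i|i|//|//] oi oj *; split; do ?[apply/over_cons; split];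
  auto; apply: over_nil.
Qed.

Lemma sbrel_split u v : sbrel true n u v -> sbrel false n u v \/
  exists2 i, idx_ok n i & (u = [:: sg i; sgi i] \/ u = [:: sgi i; sg i]) /\ v = [::].
Proof.
case=> *; try by left; constructor.
all: by right; eexists; [eassumption|auto].
Qed.

Lemma frac_sbrel u v x : sbrel true n u v ->
  frac_eq (foldr frac_cons x u) (foldr frac_cons x v).
Proof.
case/sbrel_split => [uv|[i oi [uE ->]]].
  have [pu pv] := sbrel_pos uv; rewrite !frac_pos // /frac_eq /=.
  by rewrite (flips_sbeq x.1 (sbeq_rel uv)).
have oki : ok n i by apply/andP.
have dS k : dpow k.+1 = dpow k ++ delta n.
  by rewrite -addn1 dpowD /dpow /= cats0.
case: x => k P; case: uE => ->; rewrite /frac_cons /frac_eq /num /= oki /=.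
- have fS w : flips k.+1 w = flips k (flip n w) by rewrite -addn1 flipsD.
  rewrite addn0 addn1 dS -catA fS (catA (flips _ _)) -flips_cat /=.
  (* With c the cofactor, sigma_{n-i} c sigma_i = sigma_{n-i} Delta = Delta sigma_i, and sigma_i
     cancels on the right. *)
  have -> : sbeq false n (flips k (sg (n - i) :: delta_cofactor i)) (delta n).
    rewrite -[X in sbeq _ _ _ X](flips_delta k); apply: flips_sbeq.
    apply: (cat_cancel_r (u := [:: sg i])); rewrite cat_cons (delta_cofactorP oi).
    symmetry; apply: (@delta_flip n n_ge2 [:: sg i]).
    by apply/over_cons; split=> //; apply: over_nil.
  by [].
- rewrite !addn0 addn1 dS -catA (catA (flips _ _)) -flips_cat (flips_sbeq k (delta_cofactorP oi)).
  by rewrite flips_delta.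
Qed.

Lemma frac_sbeq u v : sbeq true n u v -> frac_eq (frac u) (frac v).
Proof.
elim=> {u v} [a b u v uv|u|u v _ IH|u v w _ IH1 _ IH2].
- rewrite /frac !foldr_cat; elim: a => [|l a IH] /=; first exact: frac_sbrel.
  exact: frac_cons_eq.
- exact: frac_eq_refl.
- exact: frac_eq_sym.
- exact: frac_eq_trans IH1 IH2.
Qed.

(** A positive word applied to the trivial fraction gives itself over Delta^0, where [frac_eq] is
    equality in SB_n^+. *)
Lemma pos_embedding u v : pos_word n u -> pos_word n v ->
  sbeq true n u v -> sbeq false n u v.
Proof.
by move=> pu pv /frac_sbeq; rewrite /frac !frac_pos // /frac_eq /= !cats0.
Qed.

End Fractions.

(** * The maximal power of Delta *)

Lemma sbeq_incl n u v : sbeq false n u v -> sbeq true n u v.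
Proof.
elim=> {u v} [a b u v uv|u|u v _ IH|u v w _ IH1 _ IH2] //.
- by apply: sbeq_step; case: uv => *; try constructor.
- by symmetry.
- by rewrite IH1.
Qed.

(** [delta_inv n] is convertible to [braid_inv (delta n)]; the general form permits induction on the
    word. *)
Definition braid_inv (w : seq letter) : seq letter :=
  rev [seq match l with sg i => sgi i | sgi i => sg i | xg i => xg i end | l <- w].

Lemma braid_invr n w : braid_word n w -> sbeq true n (w ++ braid_inv w) [::].
Proof.
elim: w => [//|l w IH /over_cons [[i oi ->] bw]].
rewrite /braid_inv /= rev_cons -cats1 catA -/(braid_inv w) IH //.
by apply: sbeq_rel; constructor.
Qed.

Lemma braid_invl n w : braid_word n w -> sbeq true n (braid_inv w ++ w) [::].
Proof.
elim: w => [//|l w IH /over_cons [[i oi ->] bw]].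
rewrite /braid_inv /= rev_cons -cats1 -catA /=.
have -> : sbeq true n [:: sgi i, sg i & w] w.
  by apply: (@cat_sbeq true n [:: _; _] [::] _ w w) => //; apply: sbeq_rel; constructor.
exact: IH.
Qed.

Lemma powSr (w : seq letter) k : flatten (nseq k.+1 w) = flatten (nseq k w) ++ w.
Proof. by rewrite -addn1 nseqD flatten_cat /= cats0. Qed.

Lemma pow_inv n (u v : seq letter) k : sbeq true n (u ++ v) [::] ->
  sbeq true n (flatten (nseq k u) ++ flatten (nseq k v)) [::].
Proof.
move=> uv; elim: k => [//|k IH].
by rewrite (powSr v) /= -catA (catA _ _ v) IH.
Qed.

Section GroupSide.
Variables (n : nat) (n_ge2 : (2 <= n)%N).

Lemma delta_invr : sbeq true n (delta n ++ delta_inv n) [::].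
Proof. exact/braid_invr/delta_braid. Qed.

Lemma delta_invl : sbeq true n (delta_inv n ++ delta n) [::].
Proof. exact/braid_invl/delta_braid. Qed.

Lemma deltapow_cancel t u v :
  sbeq true n (deltapow n t ++ u) (deltapow n t ++ v) -> sbeq true n u v.
Proof.
have [c cE] : exists c, sbeq true n (c ++ deltapow n t) [::].
  case: t => k; [exists (flatten (nseq k (delta_inv n)))|
                 exists (flatten (nseq k.+1 (delta n)))]; apply: pow_inv.
  + exact: delta_invl.
  + exact: delta_invr.
move=> uv; rewrite -[u]cat0s -[v]cat0s -{1}cE -cE -!catA.
by rewrite uv.
Qed.

Lemma deltapowS (t : int) : sbeq true n (deltapow n (t + 1)%R) (deltapow n t ++ delta n).
Proof.
case: t => k.
  have -> : (Posz k + 1 = Posz k.+1)%R by lia.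
  by rewrite /deltapow powSr.
have -> : (Negz k + 1 = - (k%:Z))%R by lia.
rewrite /deltapow powSr -catA delta_invl cats0.
by case: k.
Qed.

Definition deg_letter (l : letter) : int := (if l is sgi _ then - 1 else 1)%R.
Definition deg (w : seq letter) : int := foldr (fun l d => deg_letter l + d)%R 0%R w.

Lemma deg_cat u v : deg (u ++ v) = (deg u + deg v)%R.
Proof. by elim: u => [|l u /= ->]; rewrite /=; lia. Qed.

Lemma deg_sbeq u v : sbeq true n u v -> deg u = deg v.
Proof.
elim=> {u v} [a b u v uv|//|//|u v w _ -> _ ->] //.
by rewrite !deg_cat; congr (_ + (_ + _))%R; case: uv.
Qed.

Lemma deg_pos w : pos_word n w -> deg w = Posz (size w).
Proof.
elim: w => [//|l w IH /over_cons [[_ posl] /IH /= ->]].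
by case: l posl => i posl /=; [lia|case: (posl i)|lia].
Qed.

Lemma deg_braid_inv w : braid_word n w -> deg (braid_inv w) = (- Posz (size w))%R.
Proof.
move=> bw; have := deg_sbeq (braid_invr bw); rewrite deg_cat (deg_pos (braid_pos bw)) /=; lia.
Qed.

Lemma deg_pow w k : deg (flatten (nseq k w)) = (Posz k * deg w)%R.
Proof. by elim: k => [|k IH] /=; rewrite ?deg_cat ?IH; lia. Qed.

Lemma deg_deltapow t : deg (deltapow n t) = (t * Posz (size (delta n)))%R.
Proof.
have bd := delta_braid n_ge2.
case: t => k; rewrite /deltapow deg_pow; first by rewrite deg_pos //; apply: braid_pos.
by rewrite [deg _](deg_braid_inv bd) NegzE; lia.
Qed.

Definition represents (W : seq letter) t V :=
  pos_word n V /\ sbeq true n W (deltapow n t ++ V).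

(** deg W = t |Delta| + |V| with |Delta| > 0; the absolute value covers negative degrees. *)
Lemma represents_bound W t V : represents W t V -> (t <= Posz `|deg W|%N)%R.
Proof.
case=> pV /deg_sbeq ->; rewrite deg_cat deg_deltapow deg_pos //.
have := delta_size n_ge2; move: (size (delta n)) (size V) => s v; nia.
Qed.

Lemma represents_ex W : valid_word n W -> exists t V, represents W t V.
Proof.
(* It suffices to clear denominators by a power of Delta. *)
move=> vW; suff [k [V [pV kV]]] : exists k V, pos_word n V /\ sbeq true n (dpow n k ++ W) V.
  exists (- Posz k)%R, V; split=> //.
  have -> : deltapow n (- Posz k) = flatten (nseq k (delta_inv n)) by case: k {kV}.
  by rewrite -kV catA pow_inv //; apply: delta_invl.
elim: W vW => [_|l W IH]; first by exists 0, [::]; split=> //; apply: over_nil.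
case/over_cons=> ol /IH [k [V [pV kV]]].
have shift w : pos_word n w ->
    sbeq true n (dpow n k ++ w ++ W) (flips n k w ++ V).
  by move=> pw; rewrite catA (sbeq_incl (dpow_flips n_ge2 k pw)) -catA kV.
have posw w : pos_word n w -> pos_word n (flips n k w ++ V).
  by move=> pw; apply/over_cat; split=> //; apply: flips_pos.
have single g : idx_ok n (lidx g) -> (forall i, g <> sgi i) -> pos_word n [:: g].
  by move=> ? ?; apply/over_cons; split=> //; apply: over_nil.
case: l ol => i oi.
- exists k, (flips n k [:: sg i] ++ V); have p : pos_word n [:: sg i] by apply: single.
  by split; [exact: posw|exact: (shift _ p)].
- have cE := delta_cofactorP n_ge2 oi.
  have pc : pos_word n (delta_cofactor n_ge2 i).
    have : pos_word n (delta_cofactor n_ge2 i ++ [:: sg i]).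
      by apply/(pos_word_sbeq cE)/braid_pos/delta_braid.
    by case/over_cat.
  (* An inverse letter costs one more Delta, written as a cofactor times the sigma_i that cancels
     it. *)
  exists k.+1, (flips n k (delta_cofactor n_ge2 i) ++ V); split; first exact: posw.
  rewrite /dpow powSr -/(dpow n k) -catA -shift // -(sbeq_incl cE) -!catA /=.
  have -> : sbeq true n [:: sg i, sgi i & W] W.
    by apply: (@cat_sbeq true n [:: _; _] [::] _ W W) => //; apply: sbeq_rel; constructor.
  by [].
- exists k, (flips n k [:: xg i] ++ V); have p : pos_word n [:: xg i] by apply: single.
  by split; [exact: posw|exact: (shift _ p)].
Qed.

Lemma represents_max W : valid_word n W -> exists t V, [/\ represents W t V,
  forall t' V', represents W t' V' -> (t' <= t)%R & ~ ldiv n (delta n) V].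
Proof.
move=> /represents_ex [t0 [V0 r0]].
have [t [V [rV maxt]]] : exists t V, represents W t V /\
    forall t' V', represents W t' V' -> (t' <= t)%R.
  apply: NNPP => none.
  have step k : exists t V, represents W t V /\ (t0 + Posz k <= t)%R.
    elim: k => [|k [t [V [rV kt]]]]; first by exists t0, V0; split=> //; lia.
    apply: NNPP => nw; apply: none; exists t, V; split=> // t' V' r'.
    apply: contraT => tt'; case: nw; exists t', V'; split=> //; lia.
  have [t [V [/represents_bound tb]]] := step (`|deg W| + `|t0| + 1)%N; lia.
(* If Delta divided [V], the exponent t + 1 would be attained as well. *)
exists t, V; split=> // -[c pc cE].
have /maxt : represents W (t + 1)%R c; last by lia.
split=> //; rewrite deltapowS -catA (sbeq_incl cE).
by case: rV.
Qed.

End GroupSide.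

(** * Left-greedy forms *)

Section LeftGreedy.
Variables (n : nat) (n_ge2 : (2 <= n)%N).

Lemma fword_cat fs gs : fword (fs ++ gs) = fword fs ++ fword gs.
Proof. by rewrite /fword map_cat flatten_cat. Qed.

Lemma fword_perms As : fword (map FPerm As) = flatten As.
Proof. by rewrite /fword -map_comp map_id. Qed.

Lemma greatest_sbeq B U V : pos_word n U -> sbeq false n U V ->
  greatest_br_ldiv n B U -> greatest_br_ldiv n B V.
Proof.
move=> pU UV [bB [BU maxB]]; have pV := proj1 (pos_word_sbeq UV) pU.
have E C : ldiv n C U <-> ldiv n C V by rewrite !ldivP // UV.
by split=> //; split=> [|C bC /E]; [apply/E|apply: maxB].
Qed.

Lemma greatest_ex U : pos_word n U -> exists2 B, greatest_br_ldiv n B U &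
  exists2 T, sbeq false n (B ++ T) U & forall i, ~ divides n [:: sg i] T.
Proof.
(* The gcd of [U] with itself is its greatest braid divisor; a sigma_i dividing the remainder would
   lengthen it. *)
move=> pU; have [B [bB [T TE] _ maxB]] := braid_gcd n U U.
have pB := braid_pos bB.
exists B; first by split=> //; split=> [|C bC]; rewrite !ldivP //;
  [exists T|move=> CU; apply: maxB].
exists T => // i [c cE].
have pT : pos_word n T by move/(pos_word_sbeq TE)/over_cat: pU => [].
have oi : idx_ok n i by move/(pos_word_sbeq cE)/over_cons: pT => [[]].
have bBi : braid_word n (B ++ [:: sg i]).
  by apply/over_cat; split=> //; apply/over_cons; split; [exists i|apply: over_nil].
have BiU : divides n (B ++ [:: sg i]) U by exists c; rewrite -catA cE.
by have := divides_size (maxB _ bBi BiU BiU); rewrite size_cat /=; lia.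
Qed.

Lemma greatest_unique B B' U U' : sbeq false n U U' -> pos_word n U ->
  greatest_br_ldiv n B U -> greatest_br_ldiv n B' U' -> sbeq false n B B'.
Proof.
move=> UU' pU /(greatest_sbeq pU UU') [bB [BU maxB]] [bB' [B'U maxB']].
have BB' := maxB' _ bB BU; have B'B := maxB _ bB' B'U.
move: BB' B'B; rewrite !ldivP; [|exact: braid_pos..].
by move=> BB' /divides_size; apply: divides_size_eq.
Qed.

Lemma greatest_self B : braid_word n B -> greatest_br_ldiv n B B.
Proof.
move=> bB; split=> //; split=> [|//].
by rewrite ldivP; [apply: divides_refl|apply: braid_pos].
Qed.

Lemma lgreedy_braid_word As : lgreedy_braid n As -> braid_word n (flatten As).
Proof.
elim: As => [_|A As IH /= [[bA _] /IH]]; first exact: over_nil.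
by move=> bAs; apply/over_cat.
Qed.

Lemma lfrag_divides A P : braid_word n P -> lfrag_ok n A P <->
  [/\ braid_word n A, A <> [::], divides n A (delta n), divides n A P &
   forall C, braid_word n C -> divides n C (delta n) -> divides n C P -> divides n C A].
Proof.
move=> bP; have bd := delta_braid n_ge2.
have nilE : eqP_ n A [::] <-> A = [::] by split=> [/sbeq_nil|->]; last exact: sbeq_refl.
rewrite /lfrag_ok nilE !brldivP //; split.
- case=> bA [A0 [Ad [AP maxA]]]; split=> // C bC.
  by rewrite -(brldivP _ bd) -(brldivP _ bP) -(brldivP _ bA); apply: maxA.
- case=> bA A0 Ad AP maxA; do 4![split=> //] => C bC.
  by rewrite !brldivP //; apply: maxA.
Qed.

Lemma lgreedy_ex S : braid_word n S ->
  exists2 As, lgreedy_braid n As & sbeq false n (flatten As) S.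
Proof.
have [N] := ubnP (size S); elim: N S => // N IH [|g S] szS bS; first by exists [::].
have [A [bA Ad AS maxA]] := braid_gcd n (delta n) (g :: S).
have [[i oi gE] _] := proj1 (over_cons _ _ _) bS.
(* The fragment is nontrivial, since the first sigma_i divides both Delta and the word. *)
have A0 : (0 < size A)%N.
  have [c cE] := delta_sigma n_ge2 oi.
  apply: (@divides_size n [:: sg i]); apply: maxA.
  - by apply/over_cons; split; [exists i|apply: over_nil].
  - by exists c.
  - by rewrite gE; exists S.
have [S' S'E] := AS.
have [||As gAs AsE] := IH S'.
- by move: szS; rewrite -(sbeq_size S'E) size_cat; lia.
- by move/(braid_word_sbeq S'E)/over_cat: bS => [].
have E : sbeq false n (A ++ flatten As) (g :: S) by rewrite AsE.
exists (A :: As) => //; split=> //.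
apply/lfrag_divides; first by rewrite (braid_word_sbeq E).
split=> //; first by move=> e; rewrite e in A0.
- by rewrite E.
- by move=> C bC Cd CAs; apply: maxA; rewrite -?E.
Qed.

Lemma same_frags_cat fs gs fs' gs' :
  same_frags n fs gs -> same_frags n fs' gs' -> same_frags n (fs ++ fs') (gs ++ gs').
Proof.
elim: fs gs => [|f fs IH] [|g gs] //=; first by case: f.
by case: f g => u [] v //= [? /IH]; auto.
Qed.

(** Both first fragments are the gcd of Delta with the same braid, so they divide each other;
    cancelling them leaves the tails. *)
Lemma lgreedy_unique As Bs : lgreedy_braid n As -> lgreedy_braid n Bs ->
  sbeq false n (flatten As) (flatten Bs) -> same_frags n (map FPerm As) (map FPerm Bs).
Proof.
elim: As Bs => [|A As IH] [|B Bs] //.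
- move=> _ [[_ [B0 _]] _] /sbeq_sym /sbeq_nil E; case: B0.
  by case: (B) E => //; rewrite /eqP_.
- move=> [[_ [A0 _]] _] _ /sbeq_nil E; case: A0.
  by case: (A) E => //; rewrite /eqP_.
rewrite /= => gA gB E; have bA := @lgreedy_braid_word (A :: As) gA.
have bB := @lgreedy_braid_word (B :: Bs) gB.
move: gA gB => [/(lfrag_divides _ bA) [bA1 _ Ad AP maxA] gA].
move=> [/(lfrag_divides _ bB) [bB1 _ Bd BP maxB] gB].
have AB : sbeq false n A B.
  apply: divides_size_eq; first by apply: maxB; rewrite //= -E.
  by apply: (@divides_size n); apply: maxA; rewrite //= E.
split=> //; apply: IH => //; apply: (cat_cancel_l (u := B)).
by rewrite -{1}AB.
Qed.

Lemma lg_tail_pos fs : lg_tail n fs -> pos_word n (fword fs).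
Proof.
elim=> {fs} [As /lgreedy_braid_word bAs _|As i fs /lgreedy_braid_word bAs _ oi _ _ _ IH].
  by rewrite fword_perms; apply: braid_pos.
rewrite fword_cat fword_perms; apply/over_cat; split; first exact: braid_pos.
by apply/over_cons.
Qed.

Lemma ex_least (P : nat -> Prop) i : P i -> exists2 j, P j & forall k, (k < j)%N -> ~ P k.
Proof.
have [N] := ubnP i; elim: N i => // N IH i iN Pi.
case: (classic (exists2 k, (k < i)%N & P k)) => [[k ki Pk]|none].
  by apply: (IH k) => //; lia.
by exists i => // k ki Pk; apply: none; exists k.
Qed.

Lemma lg_tail_ex V : pos_word n V -> exists2 fs, lg_tail n fs & sbeq false n (fword fs) V.
Proof.
have [N] := ubnP (size V); elim: N V => // N IH V szV pV.
have [B gB [T TE noS]] := greatest_ex pV.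
have [As gAs AsE] := lgreedy_ex (proj1 gB).
have bAs := lgreedy_braid_word gAs.
have [_ pT] : pos_word n B /\ pos_word n T.
  by apply/over_cat; move/(pos_word_sbeq TE): pV.
case: T TE noS pT => [|g T] TE noS pT.
  exists (map FPerm As); last by rewrite fword_perms AsE -TE cats0.
  by apply: lgt_end => //; apply: greatest_self.
(* The first letter of the remainder divides it, so it is not a sigma and must be an x. *)
have [i0 xi0] : exists i, divides n [:: xg i] (g :: T).
  case: g noS {TE} pT => i noS /over_cons [[_ posi] _].
  - by case: (noS i); exists T.
  - by case: (posi i).
  - by exists i, T.
have [i [T1 T1E] least] := @ex_least (fun j => divides n [:: xg j] (g :: T)) _ xi0.
have piT1 : pos_word n (xg i :: T1) by rewrite (pos_word_sbeq T1E).
have [[oi _] pT1] := proj1 (over_cons _ _ _) piT1.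
have [||fs gfs fsE] := IH T1 => //.
  by move: szV (sbeq_size T1E); rewrite -(sbeq_size TE) size_cat /=; lia.
have E : sbeq false n (xg i :: fword fs) (g :: T) by rewrite fsE.
exists (map FPerm As ++ FX i :: fs); last first.
  by rewrite fword_cat fword_perms AsE -TE -E.
have VE : sbeq false n V (flatten As ++ xg i :: fword fs) by rewrite -TE E AsE.
have pfs : pos_word n (xg i :: fword fs) by rewrite (pos_word_sbeq E).
apply: lgt_cons => //.
- apply: (greatest_sbeq pV VE); case: gB => [bB [BV maxB]]; split=> //.
  split; first by rewrite ldivP // AsE -(ldivP _ pV).
  move=> C bC CV; rewrite ldivP; last exact: braid_pos.
  by rewrite AsE -(ldivP _ (braid_pos bB)); apply: maxB.
- by rewrite ldivP //; exists (fword fs).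
- move=> j j0 ji; rewrite ldivP // E; exact: least.
Qed.

(** A word containing some x is never equal to a braid word, so both lists have the same shape;
    braid part and smallest x are then compared and cancelled. *)
Lemma lg_tail_unique fs gs : lg_tail n fs -> lg_tail n gs ->
  sbeq false n (fword fs) (fword gs) -> same_frags n fs gs.
Proof.
have no_x u i v : braid_word n (u ++ xg i :: v) -> False.
  by move=> /over_cat [_ /over_cons [[]]].
move=> gfs; elim: gfs gs => {fs} [As gAs _|As i fs gAs maxAs oi xi least gfs IH] gs.
- case=> {gs} [Bs gBs _|Bs j gs gBs _ _ _ _ _]; rewrite ?fword_cat !fword_perms => E.
    exact: lgreedy_unique.
  have := lgreedy_braid_word gAs; rewrite (braid_word_sbeq E).
  by move/no_x.
have pfs : pos_word n (xg i :: fword fs).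
  by apply/over_cons; split=> //; apply: lg_tail_pos.
have pAs : pos_word n (flatten As ++ xg i :: fword fs).
  by apply/over_cat; split=> //; apply/braid_pos/lgreedy_braid_word.
case=> {gs} [Bs gBs _|Bs j gs gBs maxBs oj xj leastj ggs];
  rewrite ?fword_cat !fword_perms => E.
  by have := lgreedy_braid_word gBs; rewrite -(braid_word_sbeq E) => /no_x.
have AB := greatest_unique E pAs maxAs maxBs.
have xE : sbeq false n (xg i :: fword fs) (xg j :: fword gs).
  by apply: (cat_cancel_l (u := flatten As)); rewrite {2}AB.
have pgs := proj1 (pos_word_sbeq xE) pfs.
have ij : i = j.
  case: (ltngtP i j) => // ij.
  - by case: (leastj i (proj1 oi) ij); rewrite ldivP // -xE; exists (fword fs).
  - by case: (least j (proj1 oj) ij); rewrite ldivP // xE; exists (fword gs).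
subst j; apply: same_frags_cat; first exact: lgreedy_unique.
by split=> //; apply: IH => //; apply: cons_cancel xE.
Qed.

Lemma left_greedy_ex W : valid_word n W -> exists t fs, left_greedy_form n W t fs.
Proof.
move/(represents_max n_ge2) => [t [V [[pV WV] maxt nd]]].
have [fs gfs fsE] := lg_tail_ex pV.
exists t, fs; split; first by rewrite /eqG (sbeq_incl fsE).
split; first by move=> t' V' pV' WV'; apply: (maxt t' V').
split=> //; rewrite ldivP; last exact: lg_tail_pos.
by rewrite fsE -(ldivP _ pV).
Qed.

Lemma left_greedy_unique W t1 fs1 t2 fs2 :
  left_greedy_form n W t1 fs1 -> left_greedy_form n W t2 fs2 ->
  t1 = t2 /\ same_frags n fs1 fs2.
Proof.
move=> [W1 [max1 [_ g1]]] [W2 [max2 [_ g2]]].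
have p1 := lg_tail_pos g1; have p2 := lg_tail_pos g2.
have t12 : t1 = t2.
  (* Each positive part competes in the maximality condition of the other form. *)
  by have := max1 _ _ p2 W2; have := max2 _ _ p1 W1; lia.
split=> //; apply: lg_tail_unique => //; apply: (pos_embedding n_ge2) => //.
by apply: (@deltapow_cancel n n_ge2 t1); rewrite {2}t12 -[X in sbeq _ _ _ X]W2 -[X in sbeq _ _ X _]W1.
Qed.

End LeftGreedy.

(** * Right-greedy forms by reversal *)

Definition rev_frag (f : frag) : frag := if f is FPerm u then FPerm (rev u) else f.
Definition rev_frags (fs : seq frag) : seq frag := rev (map rev_frag fs).
Definition rev_words (As : seq (seq letter)) : seq (seq letter) := rev (map rev As).

Lemma rev_wordsK : involutive rev_words.
Proof.
by move=> As; rewrite /rev_words map_rev revK; apply/mapK/revK.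
Qed.

Lemma rev_fragsK : involutive rev_frags.
Proof.
move=> fs; rewrite /rev_frags map_rev revK; apply: mapK.
by case=> //= u; rewrite revK.
Qed.

Lemma rev_frags_cat fs gs : rev_frags (fs ++ gs) = rev_frags gs ++ rev_frags fs.
Proof. by rewrite /rev_frags map_cat rev_cat. Qed.

Lemma rev_frags_cons f fs : rev_frags (f :: fs) = rev_frags fs ++ [:: rev_frag f].
Proof. by rewrite /rev_frags /= rev_cons -cats1. Qed.

Lemma rev_frags_perms As : rev_frags (map FPerm As) = map FPerm (rev_words As).
Proof. by rewrite /rev_frags /rev_words map_rev -!map_comp. Qed.

Lemma rev_flatten (As : seq (seq letter)) : rev (flatten As) = flatten (rev_words As).
Proof.
elim: As => [//|A As IH].
by rewrite /= rev_cat IH /rev_words /= rev_cons -cats1 flatten_cat /= cats0.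
Qed.

Lemma fword_rev fs : fword (rev_frags fs) = rev (fword fs).
Proof.
elim: fs => [//|f fs IH]; rewrite rev_frags_cons fword_cat IH /fword /= cats0 rev_cat.
by case: f.
Qed.

Lemma same_frags_rev n fs gs :
  same_frags n fs gs -> same_frags n (rev_frags fs) (rev_frags gs).
Proof.
elim: fs gs => [|f fs IH] [|g gs] //=; first by case: f.
rewrite !rev_frags_cons => H; apply: same_frags_cat.
  by case: f g H => u [] v //= [_ /IH].
by case: f g H => u [] v //= [uv _]; split=> //; apply: sbeq_rev.
Qed.

Section Mirror.
Variables (n : nat) (n_ge2 : (2 <= n)%N).

Lemma sbeq_revE inv u v : sbeq inv n (rev u) (rev v) <-> sbeq inv n u v.
Proof. by split=> [/sbeq_rev|/sbeq_rev //]; rewrite !revK. Qed.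

Lemma rdiv_rev a b : rdiv n a b <-> ldiv n (rev a) (rev b).
Proof.
split=> -[c pc cE]; exists (rev c); try exact/over_rev.
  by rewrite /eqP_ -rev_cat sbeq_revE.
by rewrite /eqP_ -sbeq_revE rev_cat revK.
Qed.

Lemma brrdiv_rev a b : brrdiv n a b <-> brldiv n (rev a) (rev b).
Proof.
split=> -[c pc cE]; exists (rev c); try exact/over_rev.
  by rewrite /eqP_ -rev_cat sbeq_revE.
by rewrite /eqP_ -sbeq_revE rev_cat revK.
Qed.

(** Palindromicity of Delta puts Delta itself, not its reverse, on the left-hand side of the
    mirror. *)
Lemma brrdiv_delta a : brrdiv n a (delta n) <-> brldiv n (rev a) (delta n).
Proof.
rewrite brrdiv_rev; have d := delta_rev n_ge2.
by split=> -[c bc cE]; exists c => //; rewrite /eqP_ in cE *; rewrite cE d.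
Qed.

Lemma braid_rev w : braid_word n (rev w) <-> braid_word n w.
Proof. exact: over_rev. Qed.

Lemma rfrag_rev A P : rfrag_ok n A P <-> lfrag_ok n (rev A) (rev P).
Proof.
have nilE : eqP_ n A [::] <-> eqP_ n (rev A) [::] by rewrite /eqP_ -(sbeq_revE _ A).
rewrite /rfrag_ok /lfrag_ok braid_rev nilE brrdiv_delta brrdiv_rev.
split=> -[? [? [? [? maxA]]]]; do 4![split=> //] => C bC.
- rewrite -(revK C) -brrdiv_delta -!brrdiv_rev; apply: maxA; exact/braid_rev.
- rewrite brrdiv_delta !brrdiv_rev; apply: maxA; exact/braid_rev.
Qed.

Lemma greatest_rev B U : greatest_br_rdiv n B U <-> greatest_br_ldiv n (rev B) (rev U).
Proof.
rewrite /greatest_br_rdiv /greatest_br_ldiv braid_rev rdiv_rev.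
split=> -[? [? maxB]]; do 2![split=> //] => C bC.
- rewrite -(revK C) -!rdiv_rev; apply: maxB; exact/braid_rev.
- rewrite !rdiv_rev; apply: maxB; exact/braid_rev.
Qed.

Lemma rgreedy_rev As : rgreedy_braid n As <-> lgreedy_braid n (rev_words As).
Proof.
rewrite /rgreedy_braid /rev_words -map_rev; elim: (rev As) => [//|A Bs IH] /=.
by rewrite IH rfrag_rev rev_cat rev_flatten /rev_words map_rev revK.
Qed.

Lemma rg_tail_rev fs : rg_tail n fs -> lg_tail n (rev_frags fs).
Proof.
elim=> {fs} [As /rgreedy_rev gAs maxAs
  |fs i As /rgreedy_rev gAs /greatest_rev maxAs oi xi least _ IH].
  rewrite rev_frags_perms; apply: lgt_end => //.
  by move/greatest_rev: maxAs; rewrite rev_flatten.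
have fsE : rev (rcons (fword fs) (xg i)) = xg i :: fword (rev_frags fs).
  by rewrite rev_rcons fword_rev.
rewrite rev_frags_cat rev_frags_cons rev_frags_perms -catA /=.
apply: lgt_cons => //.
- by move: maxAs; rewrite rev_cat rev_cons cat_rcons rev_flatten fword_rev.
- by move/rdiv_rev: xi; rewrite fsE.
- by move=> j j0 ji H; apply: (least j j0 ji); apply/rdiv_rev; rewrite fsE.
Qed.

Lemma lg_tail_rev fs : lg_tail n fs -> rg_tail n (rev_frags fs).
Proof.
elim=> {fs} [As gAs maxAs|As i fs gAs maxAs oi xi least _ IH].
  rewrite rev_frags_perms; apply: rgt_end.
    by apply/rgreedy_rev; rewrite rev_wordsK.
  by apply/greatest_rev; rewrite rev_flatten rev_wordsK.
have fsE : rev (rcons (fword (rev_frags fs)) (xg i)) = xg i :: fword fs.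
  by rewrite rev_rcons fword_rev revK.
rewrite rev_frags_cat rev_frags_cons rev_frags_perms -catA /=.
apply: rgt_cons => //.
- by apply/rgreedy_rev; rewrite rev_wordsK.
- apply/greatest_rev.
  by rewrite rev_cat rev_cons cat_rcons rev_flatten rev_wordsK fword_rev revK.
- by apply/rdiv_rev; rewrite fsE.
- by move=> j j0 ji /rdiv_rev; rewrite fsE; apply: least.
Qed.

Lemma rev_pow (w : seq letter) k : rev (flatten (nseq k w)) = flatten (nseq k (rev w)).
Proof. by elim: k => [//|k IH]; rewrite powSr rev_cat IH. Qed.

Lemma pow_sbeq inv u v k : sbeq inv n u v ->
  sbeq inv n (flatten (nseq k u)) (flatten (nseq k v)).
Proof. by move=> uv; elim: k => [//|k IH]; exact: (cat_sbeq uv IH). Qed.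

Lemma deltapow_rev t : sbeq true n (rev (deltapow n t)) (deltapow n t).
Proof.
have d : sbeq true n (rev (delta n)) (delta n) by apply/sbeq_incl/delta_rev.
case: t => k; rewrite /deltapow rev_pow; apply: pow_sbeq; first exact: d.
(* The reverse of Delta^-1 is a left inverse of rev Delta = Delta, hence equals Delta^-1. *)
rewrite -[rev _]cats0 -(delta_invr n_ge2) catA -{1}d -rev_cat.
by rewrite (sbeq_rev (delta_invr n_ge2)).
Qed.

Lemma eqG_rev W U t :
  eqG n W (U ++ deltapow n t) <-> eqG n (rev W) (deltapow n t ++ rev U).
Proof. by rewrite /eqG -sbeq_revE rev_cat deltapow_rev. Qed.

Lemma right_left_form W t fs :
  right_greedy_form n W t fs -> left_greedy_form n (rev W) t (rev_frags fs).
Proof.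
move=> [/eqG_rev WE [maxt [nd /rg_tail_rev gfs]]]; split; first by rewrite fword_rev.
split=> [t' V pV|].
  rewrite -(revK V) -eqG_rev; apply: maxt; exact/over_rev.
split=> // H; apply: nd; apply/rdiv_rev; rewrite -fword_rev.
have pfs := lg_tail_pos gfs.
by rewrite ldivP // (delta_rev n_ge2) -(ldivP _ pfs).
Qed.

Lemma left_right_form W t fs :
  left_greedy_form n (rev W) t fs -> right_greedy_form n W t (rev_frags fs).
Proof.
move=> [WE [maxt [nd gfs]]]; split; first by apply/eqG_rev; rewrite fword_rev revK.
split=> [t' V pV /eqG_rev|].
  apply: maxt; exact/over_rev.
split; last exact: lg_tail_rev.
have pfs := lg_tail_pos gfs.
move/rdiv_rev; rewrite fword_rev revK (ldivP _ pfs) (delta_rev n_ge2) => H.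
by apply: nd; rewrite ldivP.
Qed.

End Mirror.

Theorem theorem2p2 (n : nat) (hn : (2 <= n)%N) (W : seq letter) (hW : valid_word n W) :
  ((exists t fs, left_greedy_form n W t fs) /\
   (forall t1 fs1 t2 fs2, left_greedy_form n W t1 fs1 -> left_greedy_form n W t2 fs2 ->
      t1 = t2 /\ same_frags n fs1 fs2)) /\
  ((exists t fs, right_greedy_form n W t fs) /\
   (forall t1 fs1 t2 fs2, right_greedy_form n W t1 fs1 -> right_greedy_form n W t2 fs2 ->
      t1 = t2 /\ same_frags n fs1 fs2)).
Proof.
split; split.
- exact: left_greedy_ex.
- by move=> t1 fs1 t2 fs2; apply: left_greedy_unique.
(* A right form of [W] is the mirror image of a left form of [rev W]. *)
- have vW : valid_word n (rev W) by apply/over_rev.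
  have [t [fs H]] := left_greedy_ex hn vW.
  by exists t, (rev_frags fs); apply: left_right_form.
- move=> t1 fs1 t2 fs2 /(right_left_form hn) H1 /(right_left_form hn) H2.
  have [-> /same_frags_rev] := left_greedy_unique hn H1 H2.
  by rewrite !rev_fragsK.
Qed.
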